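(* Let $A\in\mathbb{C}^{N\times N}$ be such that $\frac12(A+I)+sI$ and $\frac12(A+2I)+sI$ are invertible for every integer $s\ge0$. Then for $x>0$ Young's matrix function $Y_A$ satisfies $$x\frac{d^3Y_A(x)}{dx^3}+(2I-A)\frac{d^2Y_A(x)}{dx^2}+x\frac{dY_A(x)}{dx}+(2I-A)Y_A(x)=\mathbf{0}.$$
   Context: $I$ is the $N\times N$ identity matrix and $\mathbf 0$ the zero matrix. $\Gamma^{-1}(M)$ is the reciprocal gamma function (entire) applied to a matrix $M$ by the holomorphic functional calculus; $x^M=\exp(M\ln x)$ for $x>0$. Young's matrix function is $$Y_A(x)=x^A\sum_{k=0}^\infty(-1)^k\,\Gamma^{-1}(A+(2k+1)I)\,x^{2k}.$$ *)

(* Defs.v *)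
From HB Require Import structures.
From mathcomp Require Import all_boot all_order all_algebra.
From mathcomp Require Import all_classical all_reals all_analysis.
From mathcomp Require Import complex.

Set Implicit Arguments.
Unset Strict Implicit.
Unset Printing Implicit Defensive.

Import Order.TTheory GRing.Theory Num.Theory.
Import numFieldNormedType.Exports.

Local Open Scope classical_set_scope.
Local Open Scope ring_scope.
Local Open Scope complex_scope.

(* R[i] carries no topology in the libraries: it receives the one of its
   modulus, like any numFieldType; 'M[R[i]]_N then has the entrywise one. *)
HB.instance Definition _ (R : rcfType) := NormedModule.copy R[i] R[i]^o.

Section Scalar.
Variable R : realType.

Definition cexp (z : R[i]) : R[i] :=
  (expR (complex.Re z))%:C * (cos (complex.Im z) +i* sin (complex.Im z)).

(* Reciprocal gamma function, by the Euler-Gauss product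
   1 / Gamma(z) = lim_n z (z + 1) ... (z + n) / (n! n^z), where
   n^z = exp (z ln n); the limit exists at every z in C, and is 0 at the
   poles of Gamma. *)
Definition rgamma (z : R[i]) : R[i] :=
  limn (fun n : nat => (\prod_(k < n.+1) (z + k%:R))
                       / (n`!%:R * cexp (z * (ln n%:R)%:C))).

Definition cintegral (a b : R) (g : R -> R[i]) : R[i] :=
  (\int[lebesgue_measure]_(t in `[a, b]) complex.Re (g t))
  +i* (\int[lebesgue_measure]_(t in `[a, b]) complex.Im (g t)).

Definition circle (r t : R) : R[i] := r%:C * cexp (0 +i* t).

(* Contour integral of f over the circle |z| = r, counterclockwise;
   the derivative of circle r at t is 'i * circle r t. *)
Definition circle_integral (r : R) (f : R[i] -> R[i]) : R[i] :=
  cintegral 0 (2 * pi) (fun t => f (circle r t) * ('i * circle r t)).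

End Scalar.

Section Matrix.
Variables (R : realType) (N : nat).
Implicit Types (A M : 'M[R[i]]_N) (F : R -> 'M[R[i]]_N) (x : R).

Definition mxradius M : R := 1 + \sum_i \sum_j complex.Re `|M i j|.

(* The circle |z| = mxradius M surrounds the spectrum of M. *)
Lemma eigenvalue_mxradius M (z : R[i]) :
  eigenvalue M z -> `|z| < (mxradius M)%:C.
Proof.
case/eigenvalueP=> v vM vN0.
have [j0 vj0] : exists j, v 0 j != 0.
  apply/existsP; apply: contraNT vN0 => /existsPn v0.
  by apply/eqP/rowP=> j; rewrite mxE; apply/eqP/negbNE/v0.
have ReC (w : R[i]) : (complex.Re `|w|)%:C = `|w|.
  by case: w => a b; rewrite normc_def.
pose B := \sum_i \sum_j `|M i j|.
have -> : (mxradius M)%:C = 1 + B.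
  rewrite /mxradius rmorphD rmorph1 rmorph_sum; congr (_ + _).
  by apply: eq_bigr => i _; rewrite rmorph_sum; apply: eq_bigr => j _; exact: ReC.
pose S := \sum_j `|v 0 j|.
have S_gt0 : 0 < S.
  rewrite /S (bigD1 j0) //=; apply: ltr_wpDr; last by rewrite normr_gt0.
  by apply: sumr_ge0 => j _; rewrite normr_ge0.
suff : `|z| * S <= B * S.
  by rewrite (ler_pM2r S_gt0) => zB; rewrite (le_lt_trans zB) ?ltrDr ?ltr01.
rewrite {1}/S mulr_sumr.
have -> : \sum_j `|z| * `|v 0 j| = \sum_j `|\sum_i v 0 i * M i j|.
  apply: eq_bigr => j _; rewrite -normrM; congr (`|_|).
  by move/rowP/(_ j): vM; rewrite !mxE.
rewrite /B exchange_big /= mulr_suml; apply: ler_sum => j _.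
rewrite (le_trans (ler_norm_sum _ _ _)) // mulr_suml; apply: ler_sum => i _.
rewrite normrM mulrC ler_wpM2l // /S (bigD1 i) //= lerDl sumr_ge0 // => k _.
Qed.

(* Holomorphic functional calculus of an entire function f:
   f(M) = (2 pi i)^-1 \oint f(z) (z I - M)^-1 dz.  Any contour winding once
   around the spectrum of M gives the same value, by Cauchy's theorem. *)
Definition mxholo (f : R[i] -> R[i]) M : 'M[R[i]]_N :=
  (2 * pi%:C * 'i)^-1 *:
    \matrix_(i, j) circle_integral (mxradius M)
                     (fun z => f z * invmx (z%:M - M) i j).

Definition rgamma_mx M : 'M[R[i]]_N := mxholo (@rgamma R) M.

Definition mxexp M : 'M[R[i]]_N :=
  limn (series (fun k : nat => (k`!%:R)^-1 *: M ^+ k)).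

(* x^M for x > 0 *)
Definition rpow_mx x M : 'M[R[i]]_N := mxexp ((ln x)%:C *: M).

Definition young_mx A x : 'M[R[i]]_N :=
  rpow_mx x A *m
  limn (series (fun k : nat =>
    ((-1) ^+ k * x ^+ (2 * k))%:C *: rgamma_mx (A + (2 * k + 1)%:R%:M))).

(* derive and derivable do not apply: R[i] and 'M[R[i]]_N are normed modules
   over R[i], and not over R. *)
Definition mxdiffq F x (h : R) : 'M[R[i]]_N :=
  (h^-1)%:C *: (F (x + h) - F x).

Definition mxderivable F x : Prop := cvg (mxdiffq F x h @[h --> 0^']).

Definition mxderive F x : 'M[R[i]]_N := lim (mxdiffq F x h @[h --> 0^']).

Definition mxderiven (n : nat) F : R -> 'M[R[i]]_N := iter n mxderive F.

End Matrix.

(* Main.v *)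
Require Import Defs.
From mathcomp Require Import all_boot all_order all_algebra.
From mathcomp Require Import all_classical all_reals all_analysis.
From mathcomp Require Import complex ring lra.

(** Write C_B(u) for the entire series sum_k (-1)^k Γ^-1(B + (2k+1)I) u^k, so
    that Y_A(x) = x^A C_A(x^2).  Everything formal follows from the recurrence
    Γ^-1(M) = M Γ^-1(M + I) (rgamma_mx_shift):

    - coefficientwise it gives B C_B(u) + 2u C_B'(u) = C_(B-I)(u)
      (young_series_pred); since x^A has derivative x^-1 A x^A, the j-th
      derivative of Y_A is x^(A - jI) C_(A-jI)(x^2) (mxderiven_young);
    - in C_(A-(j+2)I)(u) + u C_(A-jI)(u) all terms but the first cancel, so
      Y^(j+2) + Y^(j) = x^(A-(j+2)I) Γ^-1(A - (j+1)I) (young_deriv_gap).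

    The left-hand side of the equation is x (Y''' + Y') + (2I - A) (Y'' + Y),
    that is x^(A-2I) times Γ^-1(A - 2I) - (A - 2I) Γ^-1(A - I), which vanishes
    by the recurrence once more (young_ode).

    The analytic content is the recurrence for matrices.  The contour that
    defines Γ^-1(M) depends on M, hence Γ^-1(M) and Γ^-1(M + I) are integrals
    over different circles.  They are compared through polynomials.  The
    function 1/Γ is a limit of polynomials, uniformly on every disc
    (poly_approx_rgamma): the ratio of two consecutive Euler products is
    1 + O(1/n^2), and each of them is a polynomial times an exponential, which
    is itself the limit of (1 + z/m)^m.  For a polynomial p the contour
    integral is p(M) (mxholo_horner), as only the term in z^-1 of the Neumann
    expansion of the resolvent survives, and the integral depends continuously
    on the integrand (mxholo_approx).  So 1/Γ(z) = z 1/Γ(z + 1) passes from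
    scalars to matrices (mxholo_shift).

    The recurrence also controls the growth of the coefficients: it makes
    the norm of Γ^-1(B + (k+2)I) at most 1/(k + 1 - |B|) times the norm of
    Γ^-1(B + (k+1)I) for large k (mxrapid_rgamma), so C_B has infinite radius
    of convergence and may be differentiated term by term, entry by entry. *)

Set Implicit Arguments.
Unset Strict Implicit.
Unset Printing Implicit Defensive.
Import Order.TTheory GRing.Theory Num.Theory.
Import numFieldNormedType.Exports.
Local Open Scope classical_set_scope.
Local Open Scope ring_scope.
Local Open Scope complex_scope.

(** * The modulus of a complex number *)

Section ComplexModulus.
Variable R : realType.
Implicit Types (z w : R[i]) (x y : R).

(** The norm of R[i] takes its values in R[i]; estimates and limits are carried
    out on its real part, where the order is total. *)
Definition cabs z : R := complex.Re `|z|.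

Lemma cabsE z : `|z| = (cabs z)%:C.
Proof. by case: z => a b; rewrite /cabs normc_def. Qed.

Lemma cabs_ge0 z : 0 <= cabs z.
Proof. by rewrite -ler0c -cabsE. Qed.

Lemma cabs0 : cabs 0 = 0.
Proof. by rewrite /cabs normr0. Qed.

Lemma cabs1 : cabs 1 = 1.
Proof. by rewrite /cabs normr1. Qed.

Lemma cabsM z w : cabs (z * w) = cabs z * cabs w.
Proof. by apply: complexI; rewrite rmorphM -!cabsE normrM. Qed.

Lemma cabsX z n : cabs (z ^+ n) = cabs z ^+ n.
Proof. by apply: complexI; rewrite rmorphXn -!cabsE normrX. Qed.

Lemma cabsV z : cabs z^-1 = (cabs z)^-1.
Proof. by apply: complexI; rewrite fmorphV -!cabsE normfV. Qed.

Lemma cabsN z : cabs (- z) = cabs z.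
Proof. by rewrite /cabs normrN. Qed.

Lemma cabsD z w : cabs (z + w) <= cabs z + cabs w.
Proof. by rewrite -lecR rmorphD -!cabsE ler_normD. Qed.

Lemma cabs_sum (I : Type) (r : seq I) (P : pred I) (F : I -> R[i]) :
  cabs (\sum_(i <- r | P i) F i) <= \sum_(i <- r | P i) cabs (F i).
Proof.
elim/big_ind2 : _ => [|a b c d ab cd|//]; first by rewrite cabs0.
by rewrite (le_trans (cabsD _ _)) ?lerD.
Qed.

Lemma cabsR x : cabs x%:C = `|x|.
Proof. by rewrite /cabs normc_def /= expr0n /= addr0 sqrtr_sqr. Qed.

Lemma cabs_nat n : cabs n%:R = n%:R.
Proof. by rewrite -(rmorph_nat (real_complex R)) cabsR normr_nat. Qed.

Lemma cabs_eq0 z : (cabs z == 0) = (z == 0).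
Proof. by rewrite -(inj_eq (@complexI R)) -cabsE rmorph0 normr_eq0. Qed.

Lemma cabs_Re z : `|complex.Re z| <= cabs z.
Proof. by rewrite -lecR -cabsE normc_ge_Re. Qed.

Lemma cabs_Im z : `|complex.Im z| <= cabs z.
Proof.
have := cabs_Re (z * 'i); rewrite ReiNIm normrN cabsM.
by rewrite {2}/cabs normc_def /= !expr0n expr1n /= add0r sqrtr1 mulr1.
Qed.

Lemma cabsi : cabs 'i = 1.
Proof. by rewrite /cabs normc_def /= expr0n expr1n /= add0r sqrtr1. Qed.

Lemma cabs_ReIm z : cabs z <= `|complex.Re z| + `|complex.Im z|.
Proof.
by rewrite {1}[z]complexE (le_trans (cabsD _ _))// cabsM cabsi mul1r !cabsR.
Qed.

Lemma cvg_cabs (T : Type) (F : set_system T) {FF : Filter F} (f : T -> R[i]) w :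
  (forall e : R, 0 < e -> \forall t \near F, cabs (w - f t) < e) ->
  f t @[t --> F] --> w.
Proof.
move=> h; apply/cvgrPdist_lt => -[e e']; rewrite ltcE /= => /andP[/eqP e'0 e0].
by apply: filterS (h _ e0) => t ht; rewrite cabsE e'0 -[_ +i* _]/(e%:C) ltcR.
Qed.

Lemma cvg_cabsE (T : Type) (F : set_system T) {FF : Filter F} (f : T -> R[i]) w :
  f t @[t --> F] --> w ->
  forall e : R, 0 < e -> \forall t \near F, cabs (w - f t) < e.
Proof.
move=> /cvgrPdist_lt h e e0; have /h : 0 < e%:C :> R[i] by rewrite ltcR.
by apply: filterS => t; rewrite cabsE ltcR.
Qed.

Lemma cvg_ReIm (T : Type) (F : set_system T) {FF : Filter F}
    (f : T -> R[i]) w :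
  complex.Re (f t) @[t --> F] --> complex.Re w ->
  complex.Im (f t) @[t --> F] --> complex.Im w ->
  f t @[t --> F] --> w.
Proof.
move=> /cvgrPdist_lt h1 /cvgrPdist_lt h2; apply: cvg_cabs => e e0.
have e2 : 0 < e / 2 by rewrite divr_gt0.
near=> t; rewrite (le_lt_trans (cabs_ReIm _))// [e]splitr ltrD//.
  by rewrite raddfB/=; near: t; exact: h1.
by rewrite raddfB/=; near: t; exact: h2.
Unshelve. all: by end_near. Qed.

End ComplexModulus.

(** * The complex exponential near 0 *)

Section ComplexExponential.
Variable R : realType.
Implicit Types (z w : R[i]) (x y : R).

Lemma cexpD z w : cexp (z + w) = cexp z * cexp w.
Proof.
case: z w => [a b] [c d]; rewrite /cexp /= expRD sinD cosD.
apply/eqP; rewrite eq_complex /=; apply/andP; split; apply/eqP; ring.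
Qed.

Lemma cexp0 : cexp (0 : R[i]) = 1.
Proof. by rewrite /cexp /= expR0 cos0 sin0 mul1r. Qed.

Lemma cexp_natmul z n : cexp (n%:R * z) = cexp z ^+ n.
Proof.
elim: n => [|n ih]; first by rewrite mul0r cexp0.
by rewrite -natr1 mulrDl mul1r cexpD ih exprSr.
Qed.

Lemma cabs_cexp z : cabs (cexp z) = expR (complex.Re z).
Proof.
rewrite /cexp cabsM cabsR ger0_norm ?expR_ge0// /cabs normc_def /=.
by rewrite cos2Dsin2 sqrtr1 mulr1.
Qed.

Lemma cexp_neq0 z : cexp z != 0.
Proof. by rewrite -cabs_eq0 cabs_cexp gt_eqF ?expR_gt0. Qed.

Lemma cexpN z : cexp (- z) = (cexp z)^-1.
Proof.
apply: (mulIf (cexp_neq0 z)); rewrite -cexpD addNr cexp0 mulVf//.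
exact: cexp_neq0.
Qed.

Lemma cexpR x : cexp x%:C = (expR x)%:C.
Proof. by rewrite /cexp /= cos0 sin0 mulr1. Qed.

Let sqr_normr x : `|x| ^+ 2 = x ^+ 2.
Proof. by rewrite real_normK ?num_real. Qed.

(** Mean value inequality at 0; it yields the Taylor bounds of sin below. *)
Lemma le_norm_MVT (f df : R -> R) K b : f 0 = 0 ->
  (forall x, is_derive x 1 f (df x)) ->
  (forall c, `|c| <= `|b| -> `|df c| <= K) -> `|f b| <= K * `|b|.
Proof.
move=> f0 dfE dfK.
have cf : forall A, {within A, continuous f}.
  move=> A; apply: continuous_subspaceT => x.
  by apply/differentiable_continuous/derivable1_diffP; have [] := dfE x.
have [b0|b0] := leP 0 b.
  have [c] := MVT_segment b0 (fun x _ => dfE x) (cf _).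
  rewrite in_itv/= => /andP[c0 cb]; rewrite f0 !subr0 => ->.
  by rewrite normrM ler_wpM2r// dfK// !ger0_norm// (le_trans c0).
have [c] := MVT_segment (ltW b0) (fun x _ => dfE x) (cf _).
rewrite in_itv/= => /andP[c0 cb]; rewrite f0 !sub0r.
move=> /(congr1 Num.norm); rewrite normrN normrM normrN => ->.
rewrite ler_wpM2r// dfK// !ler0_norm ?lerN2//; exact: ltW.
Qed.

Lemma sin_le_norm x : `|sin x| <= `|x|.
Proof.
rewrite -[leRHS]mul1r.
exact: (le_norm_MVT (sin0 R) (@is_derive_sin R) (fun c _ => cos_max c)).
Qed.

Lemma cosB1_le x : `|cos x - 1| <= x ^+ 2 / 2.
Proof.
have -> : cos x - 1 = - (2 * sin (x / 2) ^+ 2).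
  by rewrite {1}[x]splitr cosD -!expr2 cos2sin2; ring.
have h : `|sin (x / 2)| <= `|x| / 2.
  by rewrite (le_trans (sin_le_norm _))// normrM normfV normr_nat.
have : `|sin (x / 2)| ^+ 2 <= (`|x| / 2) ^+ 2.
  by rewrite lerXn2r ?nnegrE// divr_ge0.
rewrite normrN normrM normr_nat normrX exprMn !sqr_normr.
lra.
Qed.

Lemma sinBid_le x : `|sin x - x| <= x ^+ 2 / 2 * `|x|.
Proof.
apply: (@le_norm_MVT (fun x => sin x - x) (fun x => cos x - 1)).
- by rewrite sin0 subr0.
- move=> c cx; rewrite (le_trans (cosB1_le _))// ler_wpM2r ?invr_ge0//.
  by rewrite -(normr_id c) in cx; rewrite -ler_sqr // !sqr_normr in cx.
Qed.

Lemma expR_le2 x : `|x| <= 1/2 -> expR x <= 2.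
Proof.
move=> h; have h1 : 1/2 <= expR (- x).
  by rewrite (le_trans _ (expR_ge1Dx _))//; move: h; rewrite ler_norml; lra.
by rewrite -[x]opprK expRN -[leRHS]invrK lef_pV2 ?posrE ?expR_gt0//; lra.
Qed.

Lemma expRB1x_le x : `|x| <= 1/2 -> `|expR x - 1 - x| <= 2 * x ^+ 2.
Proof.
move=> h; have h1 := expR_ge1Dx x.
rewrite ger0_norm; last lra.
have : expR x * (1 - x) <= 1.
  rewrite -[leRHS]expR0 -(subrr x) expRD ler_wpM2l ?expR_ge0//.
  exact: expR_ge1Dx.
have := expR_le2 h; move: h; rewrite ler_norml; nra.
Qed.

(** The local estimate of the exponential, on which rest both the speed of
    convergence of (1 + c/m)^m and the ratio of consecutive Euler products. *)
Lemma cexpB1x_le z : cabs z <= 1/2 -> cabs (cexp z - 1 - z) <= 10 * cabs z ^+ 2.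
Proof.
move=> h.
have := le_trans (cabs_Re z) h; have := le_trans (cabs_Im z) h.
have := cabs_Re z; have := cabs_Im z; have := cabs_ge0 z.
have := cabs_ReIm (cexp z - 1 - z); set c := cabs z.
case: z h @c => a b h c /=; rewrite !mul0r subr0 addr0 subr0 => hc c0 bc ac b2 a2.
apply: (le_trans hc).
have e2 := expR_le2 a2; have e1 := expRB1x_le a2; have e0 := expR_gt0 a.
have s1 := sinBid_le b; have c1 := cosB1_le b.
have a2c : a ^+ 2 <= c ^+ 2 by rewrite -sqr_normr ler_sqr ?nnegrE.
have b2c : b ^+ 2 <= c ^+ 2 by rewrite -sqr_normr ler_sqr ?nnegrE.
have c12 : c <= 1/2 by [].
have -> : expR a * cos b - 1 - a = (expR a - 1 - a) + expR a * (cos b - 1) by ring.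
have -> : expR a * sin b - b = expR a * (sin b - b) + (expR a - 1 - a) * b + a * b.
  by ring.
have i1 : `|expR a * (cos b - 1)| <= 2 * (c ^+ 2 / 2).
  by rewrite normrM (ger0_norm (ltW e0)); apply: ler_pM => //; lra.
have i2 : `|expR a * (sin b - b)| <= 2 * (c ^+ 2 / 2 * (1/2)).
  rewrite normrM (ger0_norm (ltW e0)); apply: ler_pM => //.
  by apply: le_trans s1 _; apply: ler_pM => //; [have := sqr_ge0 b|]; lra.
have i3 : `|(expR a - 1 - a) * b| <= 2 * c ^+ 2 * (1/2).
  by rewrite normrM; apply: ler_pM => //; lra.
have i4 : `|a * b| <= c ^+ 2 by rewrite normrM expr2; apply: ler_pM.
apply: le_trans (lerD (ler_normD _ _) (ler_normD _ _)) _.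
have := ler_normD (expR a * (sin b - b)) ((expR a - 1 - a) * b).
have := sqr_ge0 c; lra.
Qed.

End ComplexExponential.

(** * Uniform approximation by polynomials on discs *)

Section PolynomialApproximation.
Variable R : realType.
Implicit Types (f g : R[i] -> R[i]) (p : {poly R[i]}) (z : R[i]).

(** Entire functions have this property, by truncation of their Taylor series.
    It is the form in which the functional calculus uses them, and it passes to
    products and to uniform limits. *)
Definition poly_approx f := forall rho eps : R, 0 < eps ->
  exists p, forall z, cabs z <= rho -> cabs (f z - p.[z]) <= eps.

Lemma horner_bounded p (rho : R) :
  exists2 K : R, 0 < K & forall z, cabs z <= rho -> cabs p.[z] <= K.
Proof.
exists (1 + \sum_(i < size p) cabs p`_i * `|rho| ^+ i) => [|z zr].
  rewrite ltr_wpDr// sumr_ge0// => i _.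
  by rewrite mulr_ge0 ?cabs_ge0 ?exprn_ge0.
rewrite horner_coef (le_trans (cabs_sum _ _ _))//.
apply: (@le_trans _ _ (\sum_(i < size p) cabs p`_i * `|rho| ^+ i)); last first.
  by rewrite lerDr.
apply: ler_sum => i _.
rewrite cabsM cabsX ler_wpM2l ?cabs_ge0// lerXn2r ?nnegrE ?cabs_ge0//.
by rewrite (le_trans zr)// ler_norm.
Qed.

Lemma poly_approx_bounded f (rho : R) : poly_approx f ->
  exists2 K : R, 0 < K & forall z, cabs z <= rho -> cabs (f z) <= K.
Proof.
move=> /(_ rho 1 ltr01)[p hp]; have [K K0 pK] := horner_bounded p rho.
exists (1 + K) => [|z zr]; first by rewrite addr_gt0.
rewrite -[f z](subrK p.[z]) (le_trans (cabsD _ _))// lerD//; first exact: hp.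
exact: pK.
Qed.

Lemma poly_approx_horner p : poly_approx (fun z => p.[z]).
Proof.
by move=> rho eps e0; exists p => z _; rewrite subrr cabs0 ltW.
Qed.

Lemma poly_approxM f g :
  poly_approx f -> poly_approx g -> poly_approx (fun z => f z * g z).
Proof.
move=> hf hg rho eps e0.
have [K K0 fK] := poly_approx_bounded rho hf.
have [|q hq] := hg rho (eps / 2 / K); first by rewrite !divr_gt0.
have [L L0 qL] := horner_bounded q rho.
have [|p hp] := hf rho (eps / 2 / L); first by rewrite !divr_gt0.
exists (p * q) => z zr.
have -> : f z * g z - (p * q).[z]
        = f z * (g z - q.[z]) + (f z - p.[z]) * q.[z] by rewrite hornerM; ring.
rewrite (le_trans (cabsD _ _))// [eps]splitr !cabsM lerD//.
  rewrite -[leRHS](divfK (lt0r_neq0 K0)) mulrC.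
  by rewrite ler_pM ?cabs_ge0 ?fK ?hq.
rewrite -[leRHS](divfK (lt0r_neq0 L0)).
by rewrite ler_pM ?cabs_ge0 ?hp ?qL.
Qed.

Lemma poly_approx_unif f :
  (forall rho eps : R, 0 < eps -> exists2 g, poly_approx g &
     forall z, cabs z <= rho -> cabs (f z - g z) <= eps) -> poly_approx f.
Proof.
move=> h rho eps e0; have e2 : 0 < eps / 2 by rewrite divr_gt0.
have [g /(_ rho _ e2)[p pg] fg] := h rho _ e2.
exists p => z zr; rewrite -(subrK (g z) (f z)) -addrA.
by rewrite (le_trans (cabsD _ _))// [eps]splitr lerD ?fg ?pg.
Qed.

Lemma cabsBXX_le (a b : R[i]) (K : R) n : cabs a <= K -> cabs b <= K ->
  cabs (a ^+ n - b ^+ n) <= n%:R * cabs (a - b) * K ^+ n.-1.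
Proof.
move=> aK bK; rewrite subrXX cabsM mulrAC [leRHS]mulrC ler_wpM2l ?cabs_ge0//.
rewrite (le_trans (cabs_sum _ _ _))//.
have -> : n%:R * K ^+ n.-1 = \sum_(i < n) K ^+ n.-1.
  by rewrite sumr_const card_ord mulr_natl.
have K0 : 0 <= K by rewrite (le_trans (cabs_ge0 a)).
apply: ler_sum => i _; rewrite cabsM !cabsX.
have ni : (i <= n.-1)%N.
  by rewrite -ltnS prednK ?ltn_ord// (leq_ltn_trans _ (ltn_ord i)).
rewrite -[in leRHS](subnK ni) exprD.
apply: ler_pM => //; rewrite ?exprn_ge0 ?cabs_ge0//.
  by apply: lerXn2r; rewrite ?nnegrE ?cabs_ge0.
by apply: lerXn2r; rewrite ?nnegrE ?cabs_ge0.
Qed.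

(** With w = c/m, both terms are m-th powers, of cexp w and of 1 + w; these are
    O(|w|^2) apart and bounded by exp(t/m), so their m-th powers are O(1/m)
    apart. *)
Lemma exp_linear_le (c : R[i]) (t : R) m : cabs c <= t -> 2 * t <= m%:R ->
  (0 < m)%N ->
  cabs (cexp c - (1 + c / m%:R) ^+ m) <= 10 * t ^+ 2 * expR t / m%:R.
Proof.
move=> ct tm m0; have t0 := le_trans (cabs_ge0 c) ct.
have M0 : 0 < m%:R :> R by rewrite ltr0n.
set w := c / m%:R.
have wt : cabs w <= t / m%:R by rewrite cabsM cabsV cabs_nat ler_wpM2r ?invr_ge0 ?ler0n.
have w2 : cabs w <= 1/2.
  by rewrite (le_trans wt)// ler_pdivrMr//; lra.
have -> : cexp c = cexp w ^+ m.
  by rewrite -cexp_natmul mulrC divfK// -cabs_eq0 cabs_nat gt_eqF.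
have eK : cabs (cexp w) <= expR (t / m%:R).
  by rewrite cabs_cexp ler_expR (le_trans _ wt)// (le_trans _ (cabs_Re _))// ler_norm.
have lK : cabs (1 + w) <= expR (t / m%:R).
  rewrite (le_trans (cabsD _ _))// cabs1 (le_trans _ (expR_ge1Dx _))//.
  by rewrite lerD2l.
rewrite (le_trans (cabsBXX_le m eK lK))//.
have -> : cexp w - (1 + w) = cexp w - 1 - w by ring.
have e1 : expR (t / m%:R) ^+ m.-1 <= expR t.
  rewrite -expRM_natl ler_expR -[leRHS](divfK (lt0r_neq0 M0)) mulrC.
  by rewrite ler_wpM2l ?divr_ge0// ler_nat leq_pred.
have e2 : cabs (cexp w - 1 - w) <= 10 * (t / m%:R) ^+ 2.
  rewrite (le_trans (cexpB1x_le w2))// ler_wpM2l// lerXn2r ?nnegrE ?cabs_ge0//.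
  exact: divr_ge0.
have -> : 10 * t ^+ 2 * expR t / m%:R = m%:R * (10 * (t / m%:R) ^+ 2) * expR t.
  by field; rewrite gt_eqF.
apply: ler_pM => //; rewrite ?mulr_ge0 ?cabs_ge0 ?exprn_ge0 ?expR_ge0//.
by rewrite ler_wpM2l.
Qed.

Lemma poly_approx_cexp (c : R[i]) : poly_approx (fun z => cexp (z * c)).
Proof.
move=> rho eps e0; pose t := `|rho| * cabs c.
have t0 : 0 <= t by rewrite mulr_ge0 ?cabs_ge0.
pose m := (Num.truncn (1 + 2 * t + 10 * t ^+ 2 * expR t / eps)).+1.
have u0 : 0 <= 10 * t ^+ 2 * expR t / eps.
  apply: divr_ge0 (ltW e0); apply: mulr_ge0 (expR_ge0 _).
  by apply: mulr_ge0 (sqr_ge0 _).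
have hm : 1 + 2 * t + 10 * t ^+ 2 * expR t / eps < m%:R.
  exact: truncnS_gt.
have m0 : (0 < m)%N by rewrite -(ltr0n R); lra.
(* The polynomial (1 + cX/m)^m, with m so large that 10 t^2 exp(t) / m <= eps. *)
exists ((1 + (c / m%:R) *: 'X) ^+ m) => z zr.
rewrite horner_exp !hornerE.
have -> : 1 + c / m%:R * z = 1 + (z * c) / m%:R by rewrite mulrAC (mulrC c).
have zt : cabs (z * c) <= t.
  by rewrite cabsM ler_wpM2r ?cabs_ge0// (le_trans zr) ?ler_norm.
rewrite (le_trans (exp_linear_le zt _ m0))//; first by lra.
by rewrite ler_pdivrMr ?ltr0n// -ler_pdivrMl// mulrC; lra.
Qed.

End PolynomialApproximation.

(** * The reciprocal gamma function as a uniform limit *)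

Section ReciprocalGamma.
Variable R : realType.
Implicit Types (z : R[i]).

(** The n-th Euler-Gauss approximant of 1/Γ. *)
Definition euler_prod n z : R[i] :=
  (\prod_(k < n.+1) (z + k%:R)) / (n`!%:R * cexp (z * (ln n%:R)%:C)).

Lemma natc_neq0 n : n.+1%:R != 0 :> R[i].
Proof. by rewrite -cabs_eq0 cabs_nat pnatr_eq0. Qed.

Lemma factc_neq0 n : n`!%:R != 0 :> R[i].
Proof. by rewrite -cabs_eq0 cabs_nat pnatr_eq0 -lt0n fact_gt0. Qed.

(** The factor n^-z is an exponential, hence a limit of polynomials. *)
Lemma poly_approx_euler_prod n : poly_approx (euler_prod n).
Proof.
have -> : euler_prod n = fun z =>
    (((n`!%:R)^-1 *: \prod_(k < n.+1) ('X + (k%:R)%:P)).[z])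
      * cexp (z * - (ln n%:R)%:C).
  apply/funext => z; rewrite /euler_prod hornerZ horner_prod mulrN cexpN.
  under [in RHS]eq_bigr do rewrite !hornerE.
  by rewrite invfM; ring.
apply: poly_approxM; [exact: poly_approx_horner|exact: poly_approx_cexp].
Qed.

Lemma euler_prodS n z : (0 < n)%N -> euler_prod n.+1 z = euler_prod n z *
  ((1 + z / n.+1%:R) * cexp (- (z * (ln n.+1%:R - ln n%:R)%:C))).
Proof.
move=> n0; rewrite /euler_prod big_ord_recr /= factS natrM.
have -> : - (z * (ln n.+1%:R - ln n%:R : R)%:C)
   = z * (ln n%:R)%:C - z * (ln n.+1%:R)%:C.
  by rewrite rmorphB /=; ring.
rewrite cexpD cexpN.
have h1 := cexp_neq0 (z * (ln n.+1%:R)%:C).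
have h2 := cexp_neq0 (z * (ln n%:R)%:C).
have h3 := natc_neq0 n; have h4 := factc_neq0 n.
have -> : 1 + z / n.+1%:R = (z + n.+1%:R) / n.+1%:R.
  by rewrite mulrDl divff// addrC.
by set a := \prod_(_ < _) _; field; rewrite h1 h2 h4 nat1r h3.
Qed.

Lemma ln_succ_bounds n : (0 < n)%N ->
  (n.+1%:R)^-1 <= ln n.+1%:R - ln (n%:R : R) <= (n%:R)^-1.
Proof.
move=> n0; have n0R : 0 < n%:R :> R by rewrite ltr0n.
have n1R : 0 < n.+1%:R :> R by rewrite ltr0n.
rewrite -ln_div ?posrE//; apply/andP; split; last first.
  have -> : n.+1%:R / n%:R = 1 + n%:R^-1 :> R.
    by rewrite -natr1 mulrDl divff ?gt_eqF// mul1r.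
  by rewrite le_ln1Dx// (lt_trans _ (_ : 0 < _)) ?invr_gt0.
rewrite -[leRHS]opprK -lnV ?posrE ?divr_gt0// lerNr invf_div.
have -> : n%:R / n.+1%:R = 1 + - n.+1%:R^-1 :> R.
  by rewrite -natr1; field; rewrite gt_eqF// natr1.
by rewrite le_ln1Dx// ltrN2 invf_lt1// ltr1n.
Qed.

(** Put a = z/(n+1), L = ln(n+1) - ln n and cexp(-zL) = 1 - zL + e.  The
    quantity is (a - zL) - azL + (1 + a)e, and 1/(n+1) <= L <= 1/n makes each
    term O(1/n^2).  The bound is written as a difference so that its sums
    over n telescope. *)
Lemma euler_ratio_le z (rho : R) n : (0 < n)%N -> 1 <= rho -> cabs z <= rho ->
  2 * rho <= n%:R ->
  cabs ((1 + z / n.+1%:R) * cexp (- (z * (ln n.+1%:R - ln n%:R)%:C)) - 1)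
   <= 42 * rho ^+ 2 * (n%:R^-1 - n.+1%:R^-1).
Proof.
move=> n0 r1 zr rn; have /andP[] := ln_succ_bounds n0.
set L := ln _ - ln _ => L1 L2.
have n0R : 0 < n%:R :> R by rewrite ltr0n.
have n1R : 0 < n.+1%:R :> R by rewrite ltr0n.
have L0 : 0 <= L by rewrite (le_trans _ L1)// invr_ge0 ltW.
have zL : cabs (- (z * L%:C)) <= rho / n%:R.
  by rewrite cabsN cabsM cabsR (ger0_norm L0) ler_pM// cabs_ge0.
have rn2 : rho / n%:R <= 1/2 by rewrite ler_pdivrMr//; lra.
have := cexpB1x_le (le_trans zL rn2).
set e := cexp _ - 1 - _ => he.
have {}he : cabs e <= 10 * (rho / n%:R) ^+ 2.
  by rewrite (le_trans he)// ler_wpM2l// lerXn2r ?nnegrE ?cabs_ge0// divr_ge0//; lra.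
have -> : cexp (- (z * L%:C)) = 1 - z * L%:C + e by rewrite /e; ring.
have -> : (1 + z / n.+1%:R) * (1 - z * L%:C + e) - 1 =
   - (z * (L%:C - n.+1%:R^-1)) - z / n.+1%:R * (z * L%:C) + (1 + z / n.+1%:R) * e.
  by ring.
have d0 : n%:R^-1 - n.+1%:R^-1 = n%:R^-1 * n.+1%:R^-1 :> R.
  by rewrite -natr1; field; rewrite natr1 !gt_eqF.
have a1 : cabs (z / n.+1%:R) <= rho / n.+1%:R.
  by rewrite cabsM cabsV cabs_nat ler_wpM2r// invr_ge0 ltW.
have n1n : n.+1%:R^-1 <= n%:R^-1 :> R by rewrite lef_pV2 ?posrE// ler_nat.
have i1 : cabs (- (z * (L%:C - n.+1%:R^-1))) <= rho * (n%:R^-1 - n.+1%:R^-1).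
  rewrite cabsN cabsM ler_pM ?cabs_ge0//.
  rewrite -(rmorph_nat (real_complex R)) -fmorphV -rmorphB cabsR ger0_norm.
    by rewrite lerD2r.
  by rewrite subr_ge0.
have i2 : cabs (- (z / n.+1%:R * (z * L%:C))) <= rho / n.+1%:R * (rho / n%:R).
  by rewrite cabsN cabsM ler_pM ?cabs_ge0//; rewrite cabsN in zL.
have i3 : cabs ((1 + z / n.+1%:R) * e) <= 2 * (10 * (rho / n%:R) ^+ 2).
  rewrite cabsM ler_pM ?cabs_ge0// (le_trans (cabsD _ _))// cabs1.
  have a2 : cabs (z / n.+1%:R) <= 1/2.
    by rewrite (le_trans a1)// (le_trans _ rn2)// ler_wpM2l//; lra.
  lra.
apply: le_trans (le_trans (cabsD _ _) (lerD (cabsD _ _) (lexx _))) _.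
apply: le_trans (lerD (lerD i1 i2) i3) _; rewrite d0.
have n2 : n%:R^-1 <= 2 * n.+1%:R^-1 :> R.
  rewrite -[leLHS]mul1r ler_pdivrMr// mulrAC ler_pdivlMr// mul1r -natrM ler_nat.
  by rewrite mul2n -addnn -addn1 leq_add2l.
have ni : 0 <= n%:R^-1 :> R by rewrite invr_ge0 ltW.
have n1i : 0 <= n.+1%:R^-1 :> R by rewrite invr_ge0 ltW.
set u := n%:R^-1 in n2 ni n1n *; set v := n.+1%:R^-1 in n2 n1i n1n *.
have uv : 0 <= u * v by rewrite mulr_ge0.
have r2 : rho <= rho ^+ 2 by rewrite expr2 ler_peMr//; lra.
have j1 : rho * (u * v) <= rho ^+ 2 * (u * v) by rewrite ler_wpM2r.
have j2 : u * u <= 2 * (u * v) by rewrite mulrCA ler_wpM2l.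
have j3 : rho ^+ 2 * (u * u) <= rho ^+ 2 * (2 * (u * v)) by rewrite ler_wpM2l// sqr_ge0.
have -> : 2 * (10 * (rho * u) ^+ 2) = 20 * (rho ^+ 2 * (u * u)) by ring.
have -> : rho * v * (rho * u) = rho ^+ 2 * (u * v) by ring.
lra.
Qed.

(** Ratios 1 + O(1/n^2) have bounded products, so on the disc the increments of
    the sequence are O(1/n^2) too, and the tails of their sum are O(1/n). *)
Lemma euler_prod_cauchy (rho : R) : exists C n0,
  [/\ 0 < C, (0 < n0)%N & forall z n k, cabs z <= rho -> (n0 <= n)%N ->
    cabs (euler_prod (n + k) z - euler_prod n z) <= C / n%:R].
Proof.
wlog r1 : rho / 1 <= rho.
  move=> h; have [|C [n0 [C0 n00 Cn]]] := h (Num.max 1 rho).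
    by rewrite le_max lexx.
  by exists C, n0; split => // z n k zr; apply: Cn; rewrite le_max zr orbT.
pose n0 := ((Num.truncn (2 * rho)).+1).+1.
have hn0 n : (n0 <= n)%N -> 2 * rho <= n%:R.
  move=> nn; rewrite (le_trans (ltW (truncnS_gt _)))//.
  by rewrite ler_nat ltnW.
(* Limits of polynomials are bounded on discs: this bounds the first term. *)
have [B B0 gB] := poly_approx_bounded rho (poly_approx_euler_prod n0).
(* K (1/n0 - 1/n) bounds the sum of the logarithms of the ratios. *)
pose K := 42 * rho ^+ 2.
have K0 : 0 < K by rewrite mulr_gt0// exprn_gt0//; lra.
have gM n z : cabs z <= rho -> (n0 <= n)%N -> cabs (euler_prod n z) <= B * expR K.
  move=> zr nn.
  have pinv (m : nat) : 0 <= (m%:R)^-1 :> R by rewrite invr_ge0.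
  apply: (@le_trans _ _ (B * expR (K * (n0%:R^-1 - n%:R^-1)))); last first.
    rewrite ler_pM2l// ler_expR -[leRHS]mulr1 ler_pM2l//.
    have : n0%:R^-1 <= 1 :> R by rewrite invf_le1 ?ler1n ?ltr0n.
    have := pinv n; lra.
  elim: n nn => [|n ih]; first by rewrite leqn0 /n0.
  rewrite leq_eqVlt => /orP[/eqP <-|nn].
    by rewrite subrr mulr0 expR0 mulr1 gB.
  rewrite ltnS in nn; have n00 : (0 < n)%N by rewrite (leq_trans _ nn).
  rewrite euler_prodS// cabsM.
  have -> : K * (n0%:R^-1 - n.+1%:R^-1) =
    K * (n0%:R^-1 - n%:R^-1) + K * (n%:R^-1 - n.+1%:R^-1) by ring.
  rewrite expRD mulrA ler_pM ?cabs_ge0 ?ih//.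
  have := euler_ratio_le n00 r1 zr (hn0 _ nn).
  set q := _ * cexp _ => hq; rewrite -(subrK 1 q) (le_trans (cabsD _ _))// cabs1.
  by rewrite (le_trans _ (expR_ge1Dx _))// addrC lerD2l.
have BK : 0 < B * expR K * K by rewrite mulr_gt0// mulr_gt0 ?expR_gt0.
exists (B * expR K * K), n0; split => // z n k zr nn.
apply: (@le_trans _ _ (B * expR K * K * (n%:R^-1 - (n + k)%:R^-1))); last first.
  by rewrite ler_wpM2l ?(ltW BK)// lerBlDr lerDl invr_ge0 ler0n.
elim: k => [|k ih]; first by rewrite addn0 !subrr cabs0 mulr0.
have nk : (n0 <= n + k)%N by rewrite (leq_trans nn)// leq_addr.
have -> : euler_prod (n + k.+1) z - euler_prod n z =
   (euler_prod (n + k) z - euler_prod n z) +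
   (euler_prod (n + k.+1) z - euler_prod (n + k) z) by ring.
have -> : n%:R^-1 - (n + k.+1)%:R^-1 = (n%:R^-1 - (n + k)%:R^-1) +
   ((n + k)%:R^-1 - (n + k.+1)%:R^-1) :> R by ring.
rewrite (le_trans (cabsD _ _))// mulrDr lerD// addnS euler_prodS; last first.
  by rewrite (leq_trans _ nk).
set q := _ * cexp _; have -> : euler_prod (n + k) z * q - euler_prod (n + k) z
   = euler_prod (n + k) z * (q - 1) by ring.
rewrite cabsM -mulrA; apply: ler_pM; rewrite ?cabs_ge0 ?gM//.
by apply: euler_ratio_le => //; [rewrite (leq_trans _ nk)|exact: hn0].
Qed.

Lemma cauchy_rate_cvg (u : R^nat) (C : R) n0 : (0 < n0)%N ->
  (forall n k, (n0 <= n)%N -> `|u (n + k)%N - u n| <= C / n%:R) -> cvgn u.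
Proof.
move=> n00 h; apply/cauchy_cvgP/cauchy_exP => e e0 /=.
pose n := (n0 + (Num.truncn (C / e)).+1)%N.
have n0R : 0 < n%:R :> R by rewrite ltr0n addn_gt0 n00.
exists (u n); exists n => // m /= nm; rewrite /ball /= distrC -(subnKC nm).
rewrite (le_lt_trans (h _ _ _))// ?leq_addr//.
rewrite ltr_pdivrMr// mulrC -ltr_pdivrMr//.
rewrite (lt_le_trans (truncnS_gt _))//.
by rewrite ler_nat leq_addl.
Qed.

(** The point is uniformity: C and n0 depend on the disc only. *)
Lemma rgamma_rate (rho : R) : exists C n0,
  [/\ 0 < C, (0 < n0)%N & forall z n, cabs z <= rho -> (n0 <= n)%N ->
    cabs (rgamma z - euler_prod n z) <= C / n%:R].
Proof.
have [C [n0 [C0 n00 h]]] := euler_prod_cauchy rho.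
exists C, n0; split=> // z n zr nn.
have cvgg : euler_prod m z @[m --> \oo] --> rgamma z.
  suff [l hl] : exists l : R[i], euler_prod m z @[m --> \oo] --> l.
    have hc : cvgn (fun m => euler_prod m z) by apply/cvg_ex; exists l.
    exact: hc.
  have c1 : cvgn (fun m => complex.Re (euler_prod m z)).
    apply: (@cauchy_rate_cvg _ C n0) => // m k nm.
    rewrite -raddfB; apply: le_trans (cabs_Re _) _; exact: h.
  have c2 : cvgn (fun m => complex.Im (euler_prod m z)).
    apply: (@cauchy_rate_cvg _ C n0) => // m k nm.
    rewrite -raddfB; apply: le_trans (cabs_Im _) _; exact: h.
  exists (limn (fun m => complex.Re (euler_prod m z))
          +i* limn (fun m => complex.Im (euler_prod m z))).
  by apply: cvg_ReIm; [exact: c1|exact: c2].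
apply/ler_addgt0Pr => e e0.
have [N _ hN] := cvg_cabsE cvgg e0.
have := hN (n + N)%N (leq_addl _ _); rewrite /= => h1.
have -> : rgamma z - euler_prod n z = (euler_prod (n + N) z - euler_prod n z)
    + (rgamma z - euler_prod (n + N) z) by ring.
by rewrite (le_trans (cabsD _ _))// lerD//; [exact: h|exact: ltW].
Qed.

Lemma poly_approx_rgamma : poly_approx (@rgamma R).
Proof.
apply: poly_approx_unif => rho eps e0.
have [C [n0 [C0 n00 h]]] := rgamma_rate rho.
pose n := (n0 + (Num.truncn (C / eps)).+1)%N.
have n0R : 0 < n%:R :> R by rewrite ltr0n addn_gt0 n00.
exists (euler_prod n); first exact: poly_approx_euler_prod.
move=> z zr; rewrite (le_trans (h _ _ zr (leq_addr _ _)))//.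
rewrite ler_pdivrMr// mulrC -ler_pdivrMr//.
rewrite (le_trans (ltW (truncnS_gt _)))//.
by rewrite ler_nat leq_addl.
Qed.

(** The approximants satisfy the recurrence of 1/Γ up to a factor that tends
    to 1. *)
Lemma euler_prod_shift n z : (0 < n)%N ->
  z * euler_prod n (z + 1) = euler_prod n z * (1 + (z + 1) / n%:R).
Proof.
move=> n0; rewrite /euler_prod mulrDl mul1r cexpD cexpR lnK ?posrE ?ltr0n//.
rewrite rmorph_nat mulrA [z * _]mulrC.
have -> : \prod_(k < n.+1) (z + 1 + k%:R) * z =
          \prod_(k < n.+1) (z + k%:R) * (z + n.+1%:R).
  rewrite -[RHS](big_ord_recr n.+1 (fun k : 'I_n.+2 => z + k%:R)) /=.
  rewrite [RHS]big_ord_recl /= addr0 mulrC; congr (_ * _); apply: eq_bigr => k _.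
  by rewrite /bump /= natrD addrA.
have h1 := cexp_neq0 (z * (ln n%:R)%:C); have h4 := factc_neq0 n.
have h3 : n%:R != 0 :> R[i] by rewrite -cabs_eq0 cabs_nat gt_eqF// ltr0n.
by field; rewrite h1 h3 h4.
Qed.

Lemma rgamma_shift z : rgamma z = z * rgamma (z + 1).
Proof.
have [C [n0 [C0 n00 h]]] := rgamma_rate (cabs z + 1).
apply/eqP; rewrite -subr_eq0 -cabs_eq0 eq_le cabs_ge0 andbT.
apply/ler_addgt0Pr => e e0; rewrite add0r.
pose D := C + (cabs (rgamma z) + C) * (cabs z + 1) + cabs z * C.
pose n := (n0 + (Num.truncn (D / e)).+1)%N.
have n00' : (0 < n)%N by rewrite addn_gt0 n00.
have n0R : 0 < n%:R :> R by rewrite ltr0n.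
have n1R : n%:R^-1 <= 1 :> R by rewrite invf_le1// ler1n.
have a1 := h z n _ (leq_addr _ _); have a2 := h (z + 1) n _ (leq_addr _ _).
have {}a1 : cabs (rgamma z - euler_prod n z) <= C / n%:R by apply: a1; rewrite lerDl.
have {}a2 : cabs (rgamma (z + 1) - euler_prod n (z + 1)) <= C / n%:R.
  by apply: a2; rewrite (le_trans (cabsD _ _))// cabs1.
have a3 : cabs (euler_prod n z) <= cabs (rgamma z) + C.
  rewrite -(subKr (rgamma z) (euler_prod n z)) (le_trans (cabsD _ _))// cabsN lerD2l.
  by rewrite (le_trans a1)// ler_piMr// ltW.
(* Each of the three terms on the right is O(1/n). *)
have -> : rgamma z - z * rgamma (z + 1) = (rgamma z - euler_prod n z)
   - (euler_prod n z * ((z + 1) / n%:R)) - z * (rgamma (z + 1) - euler_prod n (z + 1)).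
  have := euler_prod_shift z n00'; rewrite mulrBr => ->; ring.
apply: (@le_trans _ _ (D / n%:R)); last first.
  rewrite ler_pdivrMr// mulrC -ler_pdivrMr//.
  rewrite (le_trans (ltW (truncnS_gt _)))//.
  by rewrite ler_nat leq_addl.
have -> : D / n%:R = C / n%:R + (cabs (rgamma z) + C) * ((cabs z + 1) / n%:R)
   + cabs z * (C / n%:R) by rewrite /D; ring.
apply: le_trans (le_trans (cabsD _ _) (lerD (cabsD _ _) (lexx _))) _.
rewrite !cabsN; apply: lerD; first apply: lerD => //.
  rewrite (cabsM (euler_prod n z)) (cabsM (z + 1)) cabsV cabs_nat.
  apply: ler_pM => //; rewrite ?cabs_ge0//.
    by rewrite mulr_ge0 ?cabs_ge0 ?invr_ge0// ltW.
  by rewrite ler_wpM2r ?invr_ge0 ?ler0n// (le_trans (cabsD _ _))// cabs1.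
by rewrite cabsM ler_wpM2l ?cabs_ge0.
Qed.

End ReciprocalGamma.

(** * Integrals of complex functions over a circle *)

Section ContourIntegral.
Variable R : realType.
Implicit Types (g : R -> R[i]) (c z : R[i]) (a b t r nu : R) (f : R -> R).

Lemma continuous_Re g : continuous g -> continuous (fun t => complex.Re (g t)).
Proof.
move=> cg t; apply/cvgrPdist_lt => e e0.
apply: filterS (cvg_cabsE (cg t) e0) => s; apply: le_lt_trans.
by rewrite -raddfB cabs_Re.
Qed.

Lemma continuous_Im g : continuous g -> continuous (fun t => complex.Im (g t)).
Proof.
move=> cg t; apply/cvgrPdist_lt => e e0.
apply: filterS (cvg_cabsE (cg t) e0) => s; apply: le_lt_trans.
by rewrite -raddfB cabs_Im.
Qed.

Lemma continuous_ReIm g : continuous (fun t => complex.Re (g t)) ->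
  continuous (fun t => complex.Im (g t)) -> continuous g.
Proof. by move=> c1 c2 t; apply: cvg_ReIm; [exact: c1|exact: c2]. Qed.

Lemma continuous_mulc g h : continuous g -> continuous h ->
  continuous (fun t => g t * h t).
Proof. by move=> cg ch t; apply: cvgM; [exact: cg|exact: ch]. Qed.

Lemma continuous_addc g h : continuous g -> continuous h ->
  continuous (fun t => g t + h t).
Proof. by move=> cg ch t; apply: cvgD; [exact: cg|exact: ch]. Qed.

Lemma continuous_cstc c : continuous (fun _ : R => c).
Proof. by move=> t; exact: cvg_cst. Qed.

Lemma integrable_cont a b f : continuous f ->
  (@lebesgue_measure R).-integrable `[a, b] (EFin \o f).
Proof.
move=> cf; apply: continuous_compact_integrable; first exact: segment_compact.
exact: continuous_subspaceT.
Qed.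

Lemma eq_int a b f h : f =1 h ->
  \int[lebesgue_measure]_(t in `[a, b]) f t
  = \int[lebesgue_measure]_(t in `[a, b]) h t.
Proof. by move=> /funext ->. Qed.

Lemma cintegralD a b g h : continuous g -> continuous h ->
  cintegral a b (fun t => g t + h t) = cintegral a b g + cintegral a b h.
Proof.
move=> cg ch; rewrite /cintegral.
under eq_Rintegral do rewrite raddfD.
rewrite RintegralD//; [|exact: integrable_cont (continuous_Re _)..].
under [X in _ +i* X]eq_Rintegral do rewrite raddfD.
by rewrite RintegralD//; exact: integrable_cont (continuous_Im _).
Qed.

(** Stated for complex constants: the real and imaginary parts get mixed. *)
Lemma cintegralZ a b c g : continuous g ->
  cintegral a b (fun t => c * g t) = c * cintegral a b g.
Proof.
move=> cg; have iR := integrable_cont a b (continuous_Re cg).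
have iI := integrable_cont a b (continuous_Im cg).
case: c => x y; rewrite /cintegral.
have cmul k (h : R -> R) : continuous h -> continuous (fun t => k * h t).
  by move=> ch t; apply: cvgMl_tmp; exact: ch.
have cR := continuous_Re cg; have cI := continuous_Im cg.
have -> : \int[lebesgue_measure]_(t in `[a, b]) complex.Re ((x +i* y) * g t)
  = \int[lebesgue_measure]_(t in `[a, b]) (x * complex.Re (g t) - y * complex.Im (g t)).
  by apply: eq_int => t; case: (g t).
have -> : \int[lebesgue_measure]_(t in `[a, b]) complex.Im ((x +i* y) * g t)
  = \int[lebesgue_measure]_(t in `[a, b]) (x * complex.Im (g t) + y * complex.Re (g t)).
  by apply: eq_int => t; case: (g t).
rewrite RintegralB//; [|exact: integrable_cont (cmul _ _ _)..].
rewrite RintegralD//; [|exact: integrable_cont (cmul _ _ _)..].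
by rewrite !RintegralZl.
Qed.

Lemma eq_cintegral a b g h : g =1 h -> cintegral a b g = cintegral a b h.
Proof. by move=> /funext ->. Qed.

Lemma cintegral0 a b : cintegral a b (fun=> 0) = 0.
Proof.
by rewrite -[RHS](mul0r (cintegral a b (fun=> 0))) -cintegralZ ?mul0r//;
  exact: continuous_cstc.
Qed.

Lemma continuous_sumc (I : Type) (s : seq I) (F : I -> R -> R[i]) :
  (forall i, continuous (F i)) -> continuous (fun t => \sum_(i <- s) F i t).
Proof.
move=> cF; elim: s => [|i s ih].
  by under eq_fun do rewrite big_nil; exact: continuous_cstc.
by under eq_fun do rewrite big_cons; exact: continuous_addc.
Qed.

Lemma cintegral_sum a b (I : Type) (s : seq I) (F : I -> R -> R[i]) :
  (forall i, continuous (F i)) ->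
  cintegral a b (fun t => \sum_(i <- s) F i t)
  = \sum_(i <- s) cintegral a b (F i).
Proof.
move=> cF; elim: s => [|i s ih].
  by under eq_cintegral do rewrite big_nil; rewrite cintegral0 big_nil.
under eq_cintegral do rewrite big_cons.
by rewrite cintegralD// ?ih ?big_cons//; exact: continuous_sumc.
Qed.

Lemma le_norm_Rintegral a b f K : a <= b -> continuous f ->
  (forall t, `|f t| <= K) ->
  `|\int[lebesgue_measure]_(t in `[a, b]) f t| <= K * (b - a).
Proof.
move=> ab cf fK; have fi := integrable_cont a b cf.
rewrite (le_trans (le_normr_Rintegral _ fi))//.
have -> : K * (b - a) = \int[lebesgue_measure]_(t in `[a, b]) (cst K t : R).
  rewrite Rintegral_cst//= lebesgue_measure_itv /= lte_fin.
  by case: ltgtP ab => //= -> _; rewrite subrr.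
apply: le_Rintegral => //.
  by apply: (@integrable_cont a b (fun t => `|f t|)) => t; apply: cvg_norm; exact: cf.
by apply: integrable_cont => t; exact: cvg_cst.
Qed.

(** The factor 2 comes from bounding the two components separately. *)
Lemma cabs_cintegral_le a b g K : a <= b -> continuous g ->
  (forall t, cabs (g t) <= K) -> cabs (cintegral a b g) <= 2 * (K * (b - a)).
Proof.
move=> ab cg gK; rewrite (le_trans (cabs_ReIm _))// mulr_natl mulr2n lerD//.
  apply: le_norm_Rintegral => //; first exact: continuous_Re.
  by move=> t; rewrite (le_trans (cabs_Re _)).
apply: le_norm_Rintegral => //; first exact: continuous_Im.
by move=> t; rewrite (le_trans (cabs_Im _)).
Qed.

Lemma Rintegral_FTC a b f F : a < b -> continuous f ->
  (forall t, is_derive t 1 F (f t)) ->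
  \int[lebesgue_measure]_(t in `[a, b]) f t = F b - F a.
Proof.
move=> ab cf dF.
have cF : continuous F.
  by move=> t; apply/differentiable_continuous/derivable1_diffP; have [] := dF t.
rewrite /Rintegral (@continuous_FTC2 _ f F)//.
- exact: continuous_subspaceT.
- split=> [t _||]; first by have [] := dF t.
  + by apply: cvg_at_right_filter; exact: cF.
  + by apply: cvg_at_left_filter; exact: cF.
- by move=> t _; rewrite derive1E; have [] := dF t.
Qed.

Lemma cexp_harmonicE nu t :
  cexp (0 +i* (nu * t)) = cos (nu * t) +i* sin (nu * t).
Proof.
by rewrite /cexp /= expR0 mul1r.
Qed.

Lemma continuous_harmonic nu : continuous (fun t => cexp (0 +i* (nu * t))).
Proof.
have cM : continuous ( *%R nu) by move=> t; apply: cvgMl_tmp; exact: cvg_id.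
under eq_fun do rewrite cexp_harmonicE.
apply: continuous_ReIm => t /=; apply: (continuous_comp (cM t)).
  exact: continuous_cos.
exact: continuous_sin.
Qed.

Lemma cintegral_harmonic nu : nu != 0 -> cos (2 * pi * nu) = 1 ->
  sin (2 * pi * nu) = 0 ->
  cintegral 0 (2 * pi) (fun t => cexp (0 +i* (nu * t))) = 0.
Proof.
move=> nu0 c1 s0; rewrite /cintegral.
have dM t : is_derive t 1 ( *%R nu) nu.
  have -> : ( *%R nu) = nu \*: (@id R) by [].
  by apply: (is_derive_eq (is_deriveZ _ _)); rewrite /= [_ *: _]mulr1.
have cM : continuous ( *%R nu).
  by move=> t; apply/differentiable_continuous/derivable1_diffP; have [] := dM t.
have cc : continuous (fun t => cos (nu * t)).
  by move=> t; apply: (continuous_comp (cM t)); exact: continuous_cos.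
have cs : continuous (fun t => sin (nu * t)).
  by move=> t; apply: (continuous_comp (cM t)); exact: continuous_sin.
have pi2 : 0 < 2 * pi :> R by rewrite mulr_gt0// pi_gt0.
rewrite (@eq_int _ _ _ (fun t => cos (nu * t))); last first.
  by move=> t; rewrite /= expR0 mul1r mul0r subr0.
rewrite (@eq_int _ _ (fun t => complex.Im _) (fun t => sin (nu * t))); last first.
  by move=> t; rewrite /= expR0 mul1r mul0r addr0.
have dS t : is_derive t 1 (fun t => nu^-1 * sin (nu * t)) (cos (nu * t)).
  have h := is_derive1_comp (is_derive_sin (nu * t)) (dM t).
  have -> : (fun t => nu^-1 * sin (nu * t)) = nu^-1 \*: (sin \o ( *%R nu)) by [].
  apply: (is_derive_eq (is_deriveZ _ h)).
  by rewrite [_ *: _]mulrCA mulVf// mulr1.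
have dC t : is_derive t 1 (fun t => - nu^-1 * cos (nu * t)) (sin (nu * t)).
  have h := is_derive1_comp (is_derive_cos (nu * t)) (dM t).
  have -> : (fun t => - nu^-1 * cos (nu * t)) = - nu^-1 \*: (cos \o ( *%R nu)) by [].
  apply: (is_derive_eq (is_deriveZ _ h)).
  by rewrite -[RHS]mul1r -(mulVf nu0) /GRing.scale /=; ring.
rewrite (Rintegral_FTC pi2 cc dS) (Rintegral_FTC pi2 cs dC).
rewrite mulr0 sin0 cos0 (mulrC nu) c1 s0 !mulr0 subrr subrr.
by [].
Qed.

Lemma cos_sin_2pin (n : nat) :
  cos (2 * pi * n%:R) = 1 :> R /\ sin (2 * pi * n%:R) = 0 :> R.
Proof.
elim: n => [|n [c1 s0]]; first by rewrite mulr0 cos0 sin0.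
have -> : 2 * pi * n.+1%:R = 2 * pi * n%:R + pi *+ 2 :> R.
  by rewrite -natr1 mulr2n; ring.
by rewrite cosD2pi sinD2pi.
Qed.

Lemma cintegral_harmonicB (k l : nat) :
  cintegral 0 (2 * pi) (fun t : R => cexp (0 +i* ((k%:R - l%:R) * t)))
   = (2 * pi * (k == l)%:R)%:C.
Proof.
have [->|kl] := eqVneq k l.
  under eq_cintegral do rewrite subrr mul0r -[_ +i* _]/(0%:C) rmorph0 cexp0.
  rewrite mulr1 /cintegral /= !Rintegral_cst//= lebesgue_measure_itv /= lte_fin.
  by rewrite mulr_gt0 ?pi_gt0//= subr0 mul0r mul1r.
rewrite mulr0 cintegral_harmonic//.
- by rewrite subr_eq0 eqr_nat.
- have [lk|lk] := leqP l k.
    by rewrite -natrB//; have [] := cos_sin_2pin (k - l).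
  rewrite -opprB -natrB 1?ltnW// mulrN cosN.
  by have [] := cos_sin_2pin (l - k).
- have [lk|lk] := leqP l k.
    by rewrite -natrB//; have [] := cos_sin_2pin (k - l).
  rewrite -opprB -natrB 1?ltnW// mulrN sinN.
  by have [_ ->] := cos_sin_2pin (l - k); rewrite oppr0.
Qed.

Lemma cabs_circle r t : 0 <= r -> cabs (circle r t) = r.
Proof. by move=> r0; rewrite cabsM cabsR ger0_norm// cabs_cexp expR0 mulr1. Qed.

Lemma circleX r t n : circle r t ^+ n = (r ^+ n)%:C * cexp (0 +i* (n%:R * t)).
Proof.
rewrite /circle exprMn -cexp_natmul rmorphXn; congr (_ * cexp _).
rewrite -(rmorph_nat (real_complex R)).
by apply/eqP; rewrite eq_complex /= !mulr0 !mul0r subrr addr0 !eqxx.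
Qed.

Lemma continuous_circle r : continuous (circle r).
Proof.
have E : circle r = fun t => r * cos t +i* (r * sin t).
  apply/funext => t; rewrite /circle /cexp /= expR0 mul1r.
  by apply/eqP; rewrite eq_complex /= !mul0r subr0 addr0 !eqxx.
rewrite E; apply: continuous_ReIm => t /=; apply: cvgMl_tmp.
  exact: continuous_cos.
exact: continuous_sin.
Qed.

(** The residue computation: among all powers of z, only z^-1 has a nonzero
    integral over the circle. *)
Lemma circle_orthogonal r (k l : nat) : 0 < r ->
  cintegral 0 (2 * pi) (fun t => circle r t ^+ k * (circle r t ^+ l)^-1)
   = (2 * pi * (k == l)%:R)%:C.
Proof.
move=> r0.
have E t : circle r t ^+ k * (circle r t ^+ l)^-1 =
    (r ^+ k / r ^+ l)%:C * cexp (0 +i* ((k%:R - l%:R) * t)).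
  rewrite !circleX invfM mulrACA -fmorphV -rmorphM; congr (_ * _).
  rewrite -cexpN -cexpD; congr cexp.
  by apply/eqP; rewrite eq_complex /= oppr0 addr0 mulrBl !eqxx.
under eq_cintegral do rewrite E.
rewrite cintegralZ ?cintegral_harmonicB; last exact: continuous_harmonic.
rewrite -rmorphM /=; have [->|] := eqVneq k l; last by rewrite !mulr0.
by rewrite divff ?mul1r// expf_neq0// gt_eqF.
Qed.

End ContourIntegral.

(** * A submultiplicative matrix norm *)

Section MatrixNorm.
Variable R : realType.

(** The entrywise norm for which mxradius M is 1 + mnorm M. *)
Definition mnorm m n (A : 'M[R[i]]_(m, n)) : R := \sum_i \sum_j cabs (A i j).

Lemma mnorm_ge0 m n (A : 'M[R[i]]_(m, n)) : 0 <= mnorm A.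
Proof. by do 2 (apply: sumr_ge0 => ? _); exact: cabs_ge0. Qed.

Lemma cabs_le_mnorm m n (A : 'M[R[i]]_(m, n)) i j : cabs (A i j) <= mnorm A.
Proof.
rewrite /mnorm (bigD1 i)//= (bigD1 j)//= -addrA lerDl addr_ge0//.
  by apply: sumr_ge0 => ? _; exact: cabs_ge0.
by do 2 (apply: sumr_ge0 => ? _); exact: cabs_ge0.
Qed.

Lemma mnorm_le m n (A : 'M[R[i]]_(m, n)) K : (forall i j, cabs (A i j) <= K) ->
  mnorm A <= m%:R * n%:R * K.
Proof.
move=> AK; apply: (@le_trans _ _ (\sum_(i < m) \sum_(j < n) K)).
  by do 2 (apply: ler_sum => ? _).
by rewrite !sumr_const !card_ord -(mulr_natl K) -(mulr_natl (n%:R * K)) mulrA.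
Qed.

Lemma mnormD m n (A B : 'M[R[i]]_(m, n)) : mnorm (A + B) <= mnorm A + mnorm B.
Proof.
rewrite /mnorm -big_split; apply: ler_sum => i _ /=.
by rewrite -big_split; apply: ler_sum => j _ /=; rewrite mxE cabsD.
Qed.

Lemma mnormN m n (A : 'M[R[i]]_(m, n)) : mnorm (- A) = mnorm A.
Proof. by do 2 (apply: eq_bigr => ? _); rewrite mxE cabsN. Qed.

Lemma mnormZ m n (A : 'M[R[i]]_(m, n)) c : mnorm (c *: A) = cabs c * mnorm A.
Proof.
rewrite /mnorm mulr_sumr; apply: eq_bigr => i _; rewrite mulr_sumr.
by apply: eq_bigr => j _; rewrite mxE cabsM.
Qed.

Lemma mnorm1 n : mnorm (1%:M : 'M[R[i]]_n) = n%:R.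
Proof.
rewrite /mnorm (eq_bigr (fun=> 1)) ?sumr_const ?card_ord// => i _.
rewrite (bigD1 i)//= big1 ?addr0 => [|j ij]; first by rewrite mxE eqxx cabs1.
by rewrite mxE eq_sym (negbTE ij) cabs0.
Qed.

Lemma mnormM m n p (A : 'M[R[i]]_(m, n)) (B : 'M[R[i]]_(n, p)) :
  mnorm (A *m B) <= mnorm A * mnorm B.
Proof.
rewrite /mnorm mulr_suml; apply: ler_sum => i _.
apply: (@le_trans _ _ (\sum_j \sum_k cabs (A i k) * cabs (B k j))).
  apply: ler_sum => j _; rewrite mxE (le_trans (cabs_sum _ _ _))//.
  by apply: ler_sum => k _; rewrite cabsM.
rewrite exchange_big /= mulr_suml; apply: ler_sum => k _.
rewrite -mulr_sumr ler_wpM2l ?cabs_ge0// (bigD1 k)//= lerDl.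
by do 2 (apply: sumr_ge0 => ? _); exact: cabs_ge0.
Qed.

Lemma mnorm_eq0 m n (A : 'M[R[i]]_(m, n)) : mnorm A <= 0 -> A = 0.
Proof.
move=> A0; apply/matrixP => i j; rewrite mxE; apply/eqP.
by rewrite -cabs_eq0 eq_le cabs_ge0 (le_trans (cabs_le_mnorm _ _ _)).
Qed.

Lemma mxradiusE n (M : 'M[R[i]]_n) : mxradius M = 1 + mnorm M.
Proof. by []. Qed.

Lemma mnormX_le n (M : 'M[R[i]]_n) k : mnorm (M ^+ k) <= n%:R * mnorm M ^+ k.
Proof.
elim: k => [|k ih]; first by rewrite !expr0 mnorm1 mulr1.
rewrite !exprSr (le_trans (mnormM _ _))// mulrA ler_wpM2r//.
exact: mnorm_ge0.
Qed.

End MatrixNorm.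

(** * The resolvent on the contour *)

Section Resolvent.
Variables (R : realType) (N : nat).
Implicit Types (M : 'M[R[i]]_N) (z w : R[i]) (t : R).

Definition resolvent M z := invmx (z%:M - M).

Lemma mxradius_gt0 M : 0 < mxradius M.
Proof. by rewrite mxradiusE ltr_pwDl// mnorm_ge0. Qed.

Lemma resolvent_unit M z : cabs z = mxradius M -> z%:M - M \in unitmx.
Proof.
move=> zM; rewrite -row_free_unit -kermx_eq0; apply/negPn/negP => h.
have : eigenvalue M z.
  rewrite /eigenvalue /eigenspace -(opprB z%:M M); apply: contra h => /eqP h.
  have : (kermx (z%:M - M) <= kermx (- (z%:M - M)))%MS.
    by apply/sub_kermxP; rewrite mulmxN mulmx_ker oppr0.
  by rewrite h submx0.
by move/eigenvalue_mxradius; rewrite cabsE zM ltxx.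
Qed.

Lemma resolventE M z : cabs z = mxradius M ->
  z *: resolvent M z = 1%:M + resolvent M z *m M.
Proof.
move=> zM; rewrite -(mulVmx (resolvent_unit zM)) -/(resolvent M z).
by rewrite mulmxBr mul_mx_scalar subrK.
Qed.

(** From z S = 1 + S M and |z| = 1 + |M| one gets (1 + |M|) |S| <= N + |S| |M|,
    hence |S| <= N: the excess 1 of the radius over the norm is what counts. *)
Lemma resolvent_le M z : cabs z = mxradius M -> mnorm (resolvent M z) <= N%:R.
Proof.
move=> zM; have := congr1 (@mnorm _ _ _) (resolventE zM).
rewrite mnormZ zM mxradiusE => h.
have := mnormD 1%:M (resolvent M z *m M); rewrite -h mnorm1.
have := mnormM (resolvent M z) M; nra.
Qed.

(** By the resolvent identity S(z) - S(w) = (w - z) S(z) S(w). *)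
Lemma resolvent_lipschitz M z w i j : cabs z = mxradius M ->
  cabs w = mxradius M ->
  cabs (resolvent M z i j - resolvent M w i j) <= N%:R ^+ 2 * cabs (z - w).
Proof.
move=> zM wM.
have E : resolvent M z - resolvent M w =
    (w - z) *: (resolvent M z *m resolvent M w).
  have uz := resolvent_unit zM; have uw := resolvent_unit wM.
  rewrite -[RHS]mul_mx_scalar -mulmxA scalar_mxC mulmxA.
  have -> : (w - z)%:M = (w%:M - M) - (z%:M - M).
    by rewrite raddfB /= opprB addrA subrK.
  by rewrite mulmxBr mulVmx// mulmxBl mul1mx -mulmxA mulmxV// mulmx1.
have -> : resolvent M z i j - resolvent M w i j = (resolvent M z - resolvent M w) i j.
  by rewrite !mxE.
rewrite (le_trans (cabs_le_mnorm _ _ _))// E mnormZ mulrC -opprB cabsN.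
rewrite ler_wpM2r ?cabs_ge0// (le_trans (mnormM _ _))// expr2.
by rewrite ler_pM ?mnorm_ge0 ?resolvent_le.
Qed.

Lemma circle_neq0 M t : circle (mxradius M) t != 0.
Proof.
rewrite -cabs_eq0 cabs_circle ?(ltW (mxradius_gt0 _))//.
by rewrite gt_eqF ?mxradius_gt0.
Qed.

Lemma cabs_circle_mxradius M t : cabs (circle (mxradius M) t) = mxradius M.
Proof. by rewrite cabs_circle// ltW ?mxradius_gt0. Qed.

Lemma continuous_resolvent M i j :
  continuous (fun t => resolvent M (circle (mxradius M) t) i j).
Proof.
move=> t; apply: cvg_cabs => e e0.
have N1 : 0 < N%:R ^+ 2 + 1 :> R by rewrite ltr_wpDl ?sqr_ge0.
have e1 : 0 < e / (N%:R ^+ 2 + 1) by rewrite divr_gt0.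
apply: filterS (cvg_cabsE (@continuous_circle R (mxradius M) t) e1) => s h.
have := resolvent_lipschitz i j (cabs_circle_mxradius M t) (cabs_circle_mxradius M s).
move/le_lt_trans; apply.
rewrite ltr_pdivlMr// in h; apply: le_lt_trans h.
by rewrite mulrC ler_wpM2l ?cabs_ge0// lerDl.
Qed.

(** Neumann expansion with an exact remainder, so that no series of matrices
    has to be summed under the integral. *)
Lemma resolvent_expansion M z m : cabs z = mxradius M -> z != 0 ->
  resolvent M z = \sum_(l < m) (z ^+ l.+1)^-1 *: M ^+ l
                  + (z ^+ m)^-1 *: (resolvent M z *m M ^+ m).
Proof.
move=> zM z0; elim: m => [|m ih].
  by rewrite big_ord0 add0r expr0 invr1 scale1r mulmx1.
rewrite {1}ih big_ord_recr /= -addrA; congr (_ + _).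
have E : resolvent M z = z^-1 *: (1%:M + resolvent M z *m M).
  by rewrite -resolventE// scalerA mulVf// scale1r.
rewrite {1}E -scalemxAl mulmxDl mul1mx scalerA -invfM -exprSr scalerDr.
by rewrite -mulmxA [M ^+ m.+1]exprS.
Qed.

End Resolvent.

(** * Contour integrals of monomials *)

Section FunctionalCalculus.
Variables (R : realType) (N : nat).
Implicit Types (M : 'M[R[i]]_N) (z w : R[i]) (t : R) (f g : R[i] -> R[i]).

Definition contour_mx f M i j t : R[i] :=
  f (circle (mxradius M) t) * resolvent M (circle (mxradius M) t) i j
  * ('i * circle (mxradius M) t).

Lemma mxholoE f M i j : mxholo f M i j =
  (2 * pi%:C * 'i)^-1 * cintegral 0 (2 * pi) (contour_mx f M i j).
Proof. by rewrite !mxE. Qed.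

Lemma cabs_imaginary : cabs ('i%R : R[i]) = 1.
Proof. by rewrite -complexiE cabsi. Qed.

Lemma pi2_ge0 : 0 <= 2 * pi :> R.
Proof. by rewrite mulr_ge0// pi_ge0. Qed.

Lemma pi2i_neq0 : 2 * pi%:C * 'i != 0 :> R[i].
Proof.
rewrite -cabs_eq0 cabsM (cabsM 2) cabs_nat cabsR cabs_imaginary mulr1.
rewrite gt_eqF// mulr_gt0//.
by rewrite normr_gt0 gt_eqF// pi_gt0.
Qed.

Lemma continuous_contour f M i j :
  continuous (fun t => f (circle (mxradius M) t)) ->
  continuous (contour_mx f M i j).
Proof.
move=> cf; have cR := @continuous_resolvent R N M i j.
have cC : continuous (fun t => 'i * circle (mxradius M) t).
  exact: continuous_mulc (@continuous_cstc _ _) (@continuous_circle _ _).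
exact: continuous_mulc (continuous_mulc cf cR) cC.
Qed.

Lemma contour_integral_le f M i j (K : R) :
  continuous (fun t => f (circle (mxradius M) t)) ->
  (forall t, cabs (f (circle (mxradius M) t)) <= K) ->
  cabs (cintegral 0 (2 * pi) (contour_mx f M i j)) <=
  2 * (2 * pi) * (K * (N%:R * mxradius M)).
Proof.
move=> cf fK.
have -> : 2 * (2 * pi) * (K * (N%:R * mxradius M))
  = 2 * (K * (N%:R * mxradius M) * (2 * pi - 0)) by ring.
apply: cabs_cintegral_le; [exact: pi2_ge0|exact: continuous_contour|].
move=> t; rewrite /contour_mx (cabsM (f _ * _)) (cabsM (f _)) (cabsM 'i%R).
rewrite cabs_imaginary mul1r cabs_circle_mxradius -mulrA.
have r0 : 0 <= mxradius M by rewrite ltW ?mxradius_gt0.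
apply: ler_pM; rewrite ?cabs_ge0 ?mulr_ge0 ?cabs_ge0//.
rewrite ler_wpM2r// (le_trans (cabs_le_mnorm _ _ _))//.
by apply: resolvent_le; exact: cabs_circle_mxradius.
Qed.

Lemma continuous_circleX r k : continuous (fun t : R => circle r t ^+ k).
Proof.
elim: k => [|k ih]; first by under eq_fun do rewrite expr0; exact: continuous_cstc.
by under eq_fun do rewrite exprS; apply: continuous_mulc ih; exact: continuous_circle.
Qed.

Lemma continuous_circleV r k : 0 < r -> continuous (fun t : R => (circle r t ^+ k)^-1).
Proof.
move=> r0 t; apply: cvgV; last exact: continuous_circleX.
by rewrite expf_neq0// -cabs_eq0 cabs_circle ?ltW// gt_eqF.
Qed.

(** In the expansion of the resolvent to order m > k, the l-th term contributes
    only for l = k, by orthogonality, and the remainder contributes at most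
    D (|M| / r)^m.  The difference of the two sides does not depend on m, and
    |M| < r. *)
Lemma contour_monomial M i j k :
  cintegral 0 (2 * pi) (contour_mx (fun z => z ^+ k) M i j)
  = 2 * pi%:C * 'i * (M ^+ k) i j.
Proof.
set r := mxradius M; have r0 : 0 < r := mxradius_gt0 M.
set c := circle r.
pose D := 2 * (2 * pi) * (r ^+ k.+1 * N%:R * N%:R) : R.
have D0 : 0 <= D by rewrite !mulr_ge0 ?pi_ge0 ?exprn_ge0 ?ler0n ?(ltW r0).
have cP l : continuous (fun t => c t ^+ k * (c t ^+ l)^-1).
  exact: continuous_mulc (@continuous_circleX r k) (@continuous_circleV r l r0).
have cT l i' j' : continuous (fun t =>
    ('i * (M ^+ l) i' j') * (c t ^+ k * (c t ^+ l)^-1)).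
  exact: continuous_mulc (@continuous_cstc _ _) (cP l).
have main m : (k < m)%N ->
    cabs (cintegral 0 (2 * pi) (contour_mx (fun z => z ^+ k) M i j)
          - 2 * pi%:C * 'i * (M ^+ k) i j) <= D * (mnorm M / r) ^+ m.
  move=> km.
  (* The contribution of the exact remainder of the Neumann expansion. *)
  pose rest t := 'i * c t ^+ k.+1 * (c t ^+ m)^-1 *
    \sum_l resolvent M (c t) i l * (M ^+ m) l j.
  have E t : contour_mx (fun z => z ^+ k) M i j t =
      (\sum_(l < m) ('i * (M ^+ l) i j) * (c t ^+ k * (c t ^+ l)^-1)) + rest t.
    have ct0 : c t != 0 := circle_neq0 M t.
    rewrite /contour_mx -/r -/c (resolvent_expansion m (cabs_circle_mxradius M t) ct0).
    rewrite -/r -/c !mxE mulrDr mulrDl; congr (_ + _); last first.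
      by rewrite /rest exprS; ring.
    rewrite summxE mulr_sumr mulr_suml; apply: eq_bigr => l _.
    rewrite mxE exprS invfM; field; by rewrite ct0 expf_neq0.
  have crest : continuous rest.
    apply: continuous_mulc; first apply: continuous_mulc; first apply: continuous_mulc.
    - exact: continuous_cstc.
    - exact: (@continuous_circleX r k.+1).
    - exact: (@continuous_circleV r m r0).
    - apply: continuous_sumc => l; apply: continuous_mulc.
        exact: continuous_resolvent.
      exact: continuous_cstc.
  under eq_cintegral do rewrite E.
  have cTm (l : 'I_m) := cT l i j.
  rewrite (cintegralD _ _ (continuous_sumc cTm) crest) (cintegral_sum _ _ _ cTm).
  have -> : \sum_(l < m) cintegral 0 (2 * pi)
      (fun t => ('i * (M ^+ l) i j) * (c t ^+ k * (c t ^+ l)^-1))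
      = 2 * pi%:C * 'i * (M ^+ k) i j.
    under eq_bigr => l _.
      rewrite (cintegralZ _ _ _ (cP l)) circle_orthogonal//; over.
    rewrite (bigD1 (Ordinal km))//= eqxx big1 ?addr0 => [|l lk].
      by rewrite mulr1 rmorphM rmorph_nat; ring.
    rewrite (_ : (k == l) = false) ?mulr0// eq_sym; apply: contraNF lk => /eqP lk.
    exact/eqP/val_inj.
  rewrite addrC addKr.
  have -> : D * (mnorm M / r) ^+ m =
     2 * (r ^+ k.+1 * (r ^+ m)^-1 * (N%:R * (N%:R * mnorm M ^+ m)) * (2 * pi - 0)).
    by rewrite /D exprMn exprVn; ring.
  apply: cabs_cintegral_le; [exact: pi2_ge0|exact: crest|].
  move=> t; rewrite /rest !(cabsM _ (\sum_l _)) !(cabsM _ (_^-1)) (cabsM 'i).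
  rewrite cabs_imaginary mul1r.
  rewrite cabsV !cabsX cabs_circle_mxradius -/r.
  apply: ler_pM; rewrite ?mulr_ge0 ?cabs_ge0 ?exprn_ge0 ?invr_ge0
    ?exprn_ge0 ?(ltW r0)//.
  have -> : \sum_l resolvent M (c t) i l * (M ^+ m) l j
      = (resolvent M (c t) *m M ^+ m) i j.
    by rewrite mxE.
  rewrite (le_trans (cabs_le_mnorm _ _ _))// (le_trans (mnormM _ _))//.
  apply: ler_pM; rewrite ?mnorm_ge0 ?mnormX_le//.
  by apply: resolvent_le; exact: cabs_circle_mxradius.
apply/eqP; rewrite -subr_eq0 -cabs_eq0 eq_le cabs_ge0 andbT.
apply/ler_addgt0Pr => e e0; rewrite add0r.
have q1 : `|mnorm M / r| < 1.
  rewrite ger0_norm ?divr_ge0 ?mnorm_ge0 ?(ltW r0)// ltr_pdivrMr// mul1r.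
  by rewrite /r mxradiusE ltrDr.
have e1 : 0 < e / (D + 1) by rewrite divr_gt0// ltr_wpDl.
have /cvgrPdist_lt /(_ _ e1) [n _ hn] := cvg_expr q1.
pose m := (n + k.+1)%N; have km : (k < m)%N by rewrite leq_addl.
rewrite (le_trans (main m km))//.
have := hn m (leq_addr _ _); rewrite /= sub0r normrN => h.
have := ler_norm ((mnorm M / r) ^+ m); move/le_lt_trans => /(_ _ h).
rewrite ltr_pdivlMr ?ltr_wpDl// => h2.
have q0 : 0 <= (mnorm M / r) ^+ m by rewrite exprn_ge0// divr_ge0 ?mnorm_ge0 ?(ltW r0).
nra.
Qed.

End FunctionalCalculus.

(** * Functional calculus of limits of polynomials *)

Section PolynomialCalculus.
Variable R : realType.
Implicit Types (z w : R[i]) (t r : R) (f g : R[i] -> R[i]) (p : {poly R[i]}).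

Lemma continuous_horner_circle r p : continuous (fun t : R => p.[circle r t]).
Proof.
elim/poly_ind: p => [|p c ih].
  by under eq_fun do rewrite horner0; exact: continuous_cstc.
under eq_fun do rewrite hornerMXaddC.
apply: continuous_addc (@continuous_cstc _ _).
exact: continuous_mulc ih (@continuous_circle _ _).
Qed.

(** A uniform limit of continuous functions on the circle. *)
Lemma continuous_approx_circle r f : 0 <= r -> poly_approx f ->
  continuous (fun t : R => f (circle r t)).
Proof.
move=> r0 hf t; apply: cvg_cabs => e e0; have e3 : 0 < e / 3 by rewrite divr_gt0.
have [p hp] := hf r _ e3.
apply: filterS (cvg_cabsE (@continuous_horner_circle r p t) e3) => s h.
have h1 : cabs (f (circle r t) - p.[circle r t]) <= e / 3.
  by apply: hp; rewrite cabs_circle.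
have h2 : cabs (f (circle r s) - p.[circle r s]) <= e / 3.
  by apply: hp; rewrite cabs_circle.
have -> : f (circle r t) - f (circle r s) =
  (f (circle r t) - p.[circle r t]) + (p.[circle r t] - p.[circle r s])
  - (f (circle r s) - p.[circle r s]) by ring.
have := cabsD (f (circle r t) - p.[circle r t] + (p.[circle r t] - p.[circle r s]))
  (- (f (circle r s) - p.[circle r s])).
have := cabsD (f (circle r t) - p.[circle r t]) (p.[circle r t] - p.[circle r s]).
rewrite cabsN; lra.
Qed.

(** On polynomials the functional calculus does not see the contour. *)
Lemma mxholo_horner N (M : 'M[R[i]]_N.+1) p :
  mxholo (horner p) M = horner_mx M p.
Proof.
rewrite -[in RHS](coefK p) poly_def rmorph_sum; apply/matrixP => i j.
rewrite mxholoE summxE.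
have cK k : continuous (contour_mx (fun z => z ^+ k) M i j).
  exact: continuous_contour (@continuous_circleX R (mxradius M) k).
have -> : contour_mx (horner p) M i j =
    fun t => \sum_(k < size p) p`_k * contour_mx (fun z => z ^+ k) M i j t.
  apply/funext => t; rewrite /contour_mx horner_coef !mulr_suml.
  by apply: eq_bigr => k _; rewrite !mulrA.
have cKp (k : 'I_(size p)) :
    continuous (fun t => p`_k * contour_mx (fun z => z ^+ k) M i j t).
  exact: continuous_mulc (@continuous_cstc _ _) (cK k).
rewrite (cintegral_sum _ _ _ cKp) mulr_sumr; apply: eq_bigr => k _.
rewrite (cintegralZ _ _ _ (cK k)) contour_monomial.
rewrite /= horner_mxZ mxE rmorphXn /= horner_mx_X.
by rewrite mulrCA mulKf// pi2i_neq0.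
Qed.

(** The constant comes from the length of the contour and the bound on the
    resolvent.  It is the same for all p, so eps may be sent to 0 afterwards.  The disc
    may be larger than the contour, which lets one p serve several matrices. *)
Lemma mxholo_approx N (M : 'M[R[i]]_N.+1) f : poly_approx f ->
  exists2 C : R, 0 <= C & forall p (rho eps : R), mxradius M <= rho ->
    (forall z, cabs z <= rho -> cabs (f z - p.[z]) <= eps) ->
    mnorm (mxholo f M - horner_mx M p) <= C * eps.
Proof.
move=> hf; have r0 := ltW (mxradius_gt0 M).
pose C0 := (cabs (2 * pi%:C * 'i%R : R[i]))^-1 *
  (2 * (2 * pi) * (N.+1%:R * mxradius M)).
have C00 : 0 <= C0.
  apply: mulr_ge0; first by rewrite invr_ge0 cabs_ge0.
  by apply: mulr_ge0; apply: mulr_ge0 => //; exact: pi2_ge0.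
exists (N.+1%:R * N.+1%:R * C0) => [|p rho eps Mrho hp].
  by apply: mulr_ge0 C00; exact: mulr_ge0.
rewrite -mxholo_horner -(mulrA _ C0); apply: mnorm_le => i j.
have cf := continuous_approx_circle r0 hf.
have cp := @continuous_horner_circle (mxradius M) p.
pose h z := f z - p.[z].
have ch : continuous (fun t => h (circle (mxradius M) t)).
  rewrite /h; apply: continuous_addc; first exact: cf.
  by move=> t; apply: cvgN; exact: cp.
have subE (A B : 'M[R[i]]_N.+1) : (A - B) i j = A i j - B i j by rewrite !mxE.
have Ef : contour_mx f M i j =
    fun t => contour_mx h M i j t + contour_mx (horner p) M i j t.
  by apply/funext => t; rewrite /contour_mx /h; ring.
have -> : (mxholo f M - mxholo (horner p) M) i j =
    (2 * pi%:C * 'i%R)^-1 * cintegral 0 (2 * pi) (contour_mx h M i j).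
  rewrite subE !mxholoE Ef.
  rewrite (cintegralD _ _ (@continuous_contour _ _ h M i j ch)
    (@continuous_contour _ _ (horner p) M i j cp)).
  by rewrite mulrDr addrK.
rewrite (cabsM _^-1) cabsV /C0 -(mulrA (cabs _)^-1) ler_wpM2l ?invr_ge0 ?cabs_ge0//.
have := @contour_integral_le R N.+1 h M i j eps ch.
have -> : 2 * (2 * pi) * (eps * (N.+1%:R * mxradius M)) =
  2 * (2 * pi) * (N.+1%:R * mxradius M) * eps by ring.
by apply=> t; apply: hp; rewrite cabs_circle_mxradius.
Qed.

Lemma mnorm_small m n (A : 'M[R[i]]_(m, n)) (K : R) :
  (forall eps : R, 0 < eps -> mnorm A <= K * eps) -> A = 0.
Proof.
move=> h; apply: mnorm_eq0; apply/ler_addgt0Pr => e e0; rewrite add0r.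
have K0 : 0 <= K by rewrite -(mulr1 K) (le_trans (mnorm_ge0 A))// h.
have e1 : 0 < e / (K + 1) by rewrite divr_gt0// ltr_wpDl.
rewrite (le_trans (h _ e1))// mulrCA ger_pMr// ler_pdivrMr ?ltr_wpDl//.
by rewrite mul1r lerDl.
Qed.

Lemma horner_mx_comp_shift N (M : 'M[R[i]]_N.+1) p :
  horner_mx M (p \Po ('X + 1%:P)) = horner_mx (M + 1%:M) p.
Proof.
elim/poly_ind: p => [|p c ih]; first by rewrite comp_poly0 !rmorph0.
rewrite comp_poly_MXaddC !rmorphD !rmorphM /= ih !horner_mx_X rmorphD /=.
by rewrite !horner_mx_X !horner_mx_C.
Qed.

(** If p is close to g on a disc surrounding both contours, then q = X p(X + 1)
    is close to f there, and q(M) = M p(M + I) holds exactly.  Both sides are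
    thus within O(eps) of each other, whatever their contours. *)
Lemma mxholo_shift N (M : 'M[R[i]]_N) f g : poly_approx f -> poly_approx g ->
  (forall z, f z = z * g (z + 1)) ->
  mxholo f M = M *m mxholo g (M + 1%:M).
Proof.
case: N M => [|N] M hf hg fg; first by rewrite [LHS]flatmx0 [RHS]flatmx0.
have [C C0 hC] := mxholo_approx M hf.
have [D D0 hD] := mxholo_approx (M + 1%:M) hg.
(* p is needed on the disc of radius rho + 1, where z + 1 lives when |z| <= rho. *)
pose rho := Num.max (mxradius M) (mxradius (M + 1%:M)).
have r0 : 0 <= rho by rewrite le_max ltW ?mxradius_gt0.
apply/eqP; rewrite -subr_eq0; apply/eqP.
apply: (@mnorm_small _ _ _ (C * rho + mnorm M * D)) => eps e0.
have [p hp] := hg (rho + 1) eps e0.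
have {}hD : mnorm (mxholo g (M + 1%:M) - horner_mx (M + 1%:M) p) <= D * eps.
  by apply: (hD p (rho + 1)) => //; rewrite ler_wpDr// le_max lexx orbT.
pose q := 'X * (p \Po ('X + 1%:P)).
have {}hC : mnorm (mxholo f M - horner_mx M q) <= C * (rho * eps).
  apply: (hC q rho) => [|z zr]; first by rewrite le_max lexx.
  rewrite /q hornerM horner_comp !hornerE fg -mulrBr cabsM ler_pM ?cabs_ge0//.
  by apply: hp; rewrite (le_trans (cabsD _ _))// cabs1 lerD2r.
have qE : horner_mx M q = M *m horner_mx (M + 1%:M) p.
  by rewrite /q rmorphM /= horner_mx_X horner_mx_comp_shift.
have -> : mxholo f M - M *m mxholo g (M + 1%:M) = (mxholo f M - horner_mx M q)
   - M *m (mxholo g (M + 1%:M) - horner_mx (M + 1%:M) p).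
  by rewrite mulmxBr qE opprB addrA subrK.
rewrite (le_trans (mnormD _ _))// mnormN mulrDl -mulrA lerD//.
by rewrite (le_trans (mnormM _ _))// -mulrA ler_wpM2l// mnorm_ge0.
Qed.

End PolynomialCalculus.

(** * Limits of matrices *)

Section MatrixLimits.
Variables (R : realType) (m n : nat).
Implicit Types (L : 'M[R[i]]_(m, n)).

(** The topology of matrices is the product topology. *)
Lemma cvg_mxP (T : Type) (F : set_system T) {FF : Filter F}
    (f : T -> 'M[R[i]]_(m, n)) L :
  f t @[t --> F] --> L <-> forall i j, f t i j @[t --> F] --> L i j.
Proof.
split=> [fL i j A LA|h A [P LP PA]].
  apply: (fL [set M : 'M[R[i]]_(m, n) | A (M i j)]).
  exists (fun i' j' => if (i' == i) && (j' == j) then A else setT)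
    => [i' j'|M /(_ i j)].
    case: ifP => [/andP[/eqP -> /eqP ->]|_]; first exact: LA.
    exact: filterT.
  by rewrite !eqxx.
have : \forall t \near F, forall i j, P i j (f t i j).
  apply: filter_forall => i; apply: filter_forall => j.
  exact: (h i j _ (LP i j)).
by apply: filterS => t ht; apply: PA.
Qed.

Lemma mx_hausdorff : hausdorff_space 'M[R[i]]_(m, n).
Proof.
move=> M L ML; apply/matrixP => i j.
apply: (@norm_hausdorff R[i] R[i]) => A B MA LB.
have hM : nbhs M [set X : 'M[R[i]]_(m, n) | A (X i j)].
  by apply: (proj1 (cvg_mxP _ _) (@cvg_id _ (nbhs M)) i j); exact: MA.
have hL : nbhs L [set X : 'M[R[i]]_(m, n) | B (X i j)].
  by apply: (proj1 (cvg_mxP _ _) (@cvg_id _ (nbhs L)) i j); exact: LB.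
by have [X [AX BX]] := ML _ _ hM hL; exists (X i j).
Qed.

End MatrixLimits.

Lemma cvg_sumc (R : realType) (T : Type) (F : set_system T) {FF : Filter F}
    (I : Type) (s : seq I) (f : I -> T -> R[i]) (l : I -> R[i]) :
  (forall i, f i t @[t --> F] --> l i) ->
  \sum_(i <- s) f i t @[t --> F] --> \sum_(i <- s) l i.
Proof.
move=> h; elim: s => [|i s ih].
  by under eq_fun do rewrite big_nil; rewrite big_nil; exact: cvg_cst.
by under eq_fun do rewrite big_cons; rewrite big_cons; exact: cvgD (h i) ih.
Qed.

Lemma cvg_mulmx (R : realType) (T : Type) (F : set_system T) {FF : Filter F}
    (m n p : nat) (f : T -> 'M[R[i]]_(m, n)) (g : T -> 'M[R[i]]_(n, p))
    (A : 'M[R[i]]_(m, n)) (B : 'M[R[i]]_(n, p)) :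
  f t @[t --> F] --> A -> g t @[t --> F] --> B ->
  f t *m g t @[t --> F] --> A *m B.
Proof.
move=> /cvg_mxP fA /cvg_mxP gB; apply/cvg_mxP => i j; rewrite mxE.
under eq_fun do rewrite mxE.
by apply: cvg_sumc => k; exact: cvgM (fA i k) (gB k j).
Qed.

Lemma cvg_addmx (R : realType) (T : Type) (F : set_system T) {FF : Filter F}
    (m n : nat) (f g : T -> 'M[R[i]]_(m, n)) (A B : 'M[R[i]]_(m, n)) :
  f t @[t --> F] --> A -> g t @[t --> F] --> B ->
  f t + g t @[t --> F] --> A + B.
Proof.
move=> /cvg_mxP fA /cvg_mxP gB; apply/cvg_mxP => i j; rewrite mxE.
under eq_fun do rewrite mxE.
exact: cvgD (fA i j) (gB i j).
Qed.

(** * Derivatives of matrix functions of a real variable *)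

Section MatrixDerivative.
Variable R : realType.
Implicit Types (g h : R -> R[i]) (x y : R) (d e : R[i]).

(** Real differentiability of a complex function, expressed on its two real
    components so that the calculus of real functions applies. *)
Definition is_cderive x g d :=
  is_derive x 1 (fun y => complex.Re (g y)) (complex.Re d) /\
  is_derive x 1 (fun y => complex.Im (g y)) (complex.Im d).

Lemma is_cderiveD x g h d e : is_cderive x g d -> is_cderive x h e ->
  is_cderive x (fun y => g y + h y) (d + e).
Proof.
move=> [g1 g2] [h1 h2]; split.
  under eq_fun do rewrite raddfD; rewrite raddfD; exact: is_deriveD.
under eq_fun do rewrite raddfD; rewrite raddfD; exact: is_deriveD.
Qed.

Lemma is_cderive_cst x d : is_cderive x (fun=> d) 0.
Proof. by split; exact: is_derive_cst. Qed.

Lemma Re_add (z w : R[i]) : complex.Re (z + w) = complex.Re z + complex.Re w.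
Proof. by case: z w => ? ? []. Qed.

Lemma Im_add (z w : R[i]) : complex.Im (z + w) = complex.Im z + complex.Im w.
Proof. by case: z w => ? ? []. Qed.

Lemma Re_mul (z w : R[i]) : complex.Re (z * w) =
  complex.Re z * complex.Re w - complex.Im z * complex.Im w.
Proof. by case: z w => ? ? []. Qed.

Lemma Im_mul (z w : R[i]) : complex.Im (z * w) =
  complex.Re z * complex.Im w + complex.Im z * complex.Re w.
Proof. by case: z w => ? ? []. Qed.

Lemma is_cderiveM x g h d e : is_cderive x g d -> is_cderive x h e ->
  is_cderive x (fun y => g y * h y) (d * h x + g x * e).
Proof.
move=> [g1 g2] [h1 h2]; split.
  have -> : (fun y => complex.Re (g y * h y)) =
     (fun y => complex.Re (g y)) * (fun y => complex.Re (h y))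
     - (fun y => complex.Im (g y)) * (fun y => complex.Im (h y)).
    by apply/funext => y; exact: Re_mul.
  apply: (is_derive_eq (is_deriveB (is_deriveM g1 h1) (is_deriveM g2 h2))).
  by rewrite Re_add !Re_mul /GRing.scale /=; ring.
have -> : (fun y => complex.Im (g y * h y)) =
   (fun y => complex.Re (g y)) * (fun y => complex.Im (h y))
   + (fun y => complex.Im (g y)) * (fun y => complex.Re (h y)).
  by apply/funext => y; exact: Im_mul.
apply: (is_derive_eq (is_deriveD (is_deriveM g1 h2) (is_deriveM g2 h1))).
by rewrite Im_add !Im_mul /GRing.scale /=; ring.
Qed.

Lemma is_cderive_sum x (I : Type) (s : seq I) (g : I -> R -> R[i]) (d : I -> R[i]) :
  (forall i, is_cderive x (g i) (d i)) ->
  is_cderive x (fun y => \sum_(i <- s) g i y) (\sum_(i <- s) d i).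
Proof.
move=> h; elim: s => [|i s ih].
  by under eq_fun do rewrite big_nil; rewrite big_nil; exact: is_cderive_cst.
by under eq_fun do rewrite big_cons; rewrite big_cons; exact: is_cderiveD.
Qed.

Lemma is_cderive_real x (f : R -> R) df : is_derive x 1 f df ->
  is_cderive x (fun y => (f y)%:C) df%:C.
Proof. by move=> h; split; [exact: h|exact: is_derive_cst]. Qed.

Lemma cvg_diffq (f : R -> R) x df : is_derive x 1 f df ->
  (h : R)^-1 * (f (x + h) - f x) @[h --> 0^'] --> df.
Proof.
have E : (fun h : R => h^-1 *: ((f \o shift x) (h *: (1 : R)) - f x))
   = fun h : R => h^-1 * (f (x + h) - f x).
  by apply/funext => h; rewrite /= [h *: _]mulr1 (addrC h).
by move=> [+ <-]; rewrite /derivable /derive E.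
Qed.

Definition is_mxderive m n x (F : R -> 'M[R[i]]_(m, n)) (D : 'M[R[i]]_(m, n)) :=
  forall i j, is_cderive x (fun y => F y i j) (D i j).

Lemma cvg_mxdiffq n x (F : R -> 'M[R[i]]_n) D : is_mxderive x F D ->
  mxdiffq F x k @[k --> 0^'] --> D.
Proof.
move=> FD; apply/cvg_mxP => i j; have [d1 d2] := FD i j.
have E (k : R) : mxdiffq F x k i j = (k^-1)%:C * (F (x + k) i j - F x i j).
  by rewrite !mxE.
under eq_fun do rewrite E.
apply: cvg_ReIm.
  rewrite (_ : (fun k => _) = fun k : R =>
      k^-1 * (complex.Re (F (x + k) i j) - complex.Re (F x i j))).
    exact: cvg_diffq d1.
  by apply/funext => k; rewrite Re_mul Re_add /= mul0r subr0; case: (F x i j).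
rewrite (_ : (fun k => _) = fun k : R =>
    k^-1 * (complex.Im (F (x + k) i j) - complex.Im (F x i j))).
  exact: cvg_diffq d2.
by apply/funext => k; rewrite Im_mul Im_add /= mul0r addr0; case: (F x i j).
Qed.

Lemma mxderivable_is n x (F : R -> 'M[R[i]]_n) D : is_mxderive x F D ->
  mxderivable F x.
Proof. by move=> /cvg_mxdiffq h; apply/cvg_ex; exists D. Qed.

Lemma mxderive_is n x (F : R -> 'M[R[i]]_n) D : is_mxderive x F D ->
  mxderive F x = D.
Proof. move=> /cvg_mxdiffq h; apply: cvg_lim h; exact: mx_hausdorff. Qed.

Lemma is_mxderive_near m n x (F G : R -> 'M[R[i]]_(m, n)) D :
  (\forall y \near x, F y = G y) -> is_mxderive x F D -> is_mxderive x G D.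
Proof.
move=> FG FD i j; have [d1 d2] := FD i j; split.
  by apply: near_eq_is_derive d1; apply: filterS FG => y ->.
by apply: near_eq_is_derive d2; apply: filterS FG => y ->.
Qed.

Lemma is_mxderiveM m n p x (F : R -> 'M[R[i]]_(m, n)) (G : R -> 'M[R[i]]_(n, p)) D E :
  is_mxderive x F D -> is_mxderive x G E ->
  is_mxderive x (fun y => F y *m G y) (D *m G x + F x *m E).
Proof.
move=> FD GE i j.
have -> : (D *m G x + F x *m E) i j =
   \sum_k (D i k * G x k j + F x i k * E k j) by rewrite !mxE big_split.
have -> : (fun y => (F y *m G y) i j) = fun y => \sum_k (F y i k * G y k j).
  by apply/funext => y; rewrite mxE.
by apply: is_cderive_sum => k; apply: is_cderiveM.
Qed.

Lemma is_mxderiveZ m n x (f : R -> R) df (F : R -> 'M[R[i]]_(m, n)) D :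
  is_derive x 1 f df -> is_mxderive x F D ->
  is_mxderive x (fun y => (f y)%:C *: F y) (df%:C *: F x + (f x)%:C *: D).
Proof.
move=> fd FD i j.
have -> : (df%:C *: F x + (f x)%:C *: D) i j = df%:C * F x i j + (f x)%:C * D i j.
  by rewrite !mxE.
have -> : (fun y => ((f y)%:C *: F y) i j) = fun y => (f y)%:C * F y i j.
  by apply/funext => y; rewrite mxE.
exact: is_cderiveM (is_cderive_real fd) (FD i j).
Qed.

Lemma is_mxderive_comp m n x (f : R -> R) df (F : R -> 'M[R[i]]_(m, n)) D :
  is_derive x 1 f df -> is_mxderive (f x) F D ->
  is_mxderive x (F \o f) (df%:C *: D).
Proof.
move=> fd FD i j; have [d1 d2] := FD i j; rewrite mxE; split.
  apply: (is_derive_eq (is_derive1_comp d1 fd)).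
  by case: (D i j) => ? ? /=; ring.
apply: (is_derive_eq (is_derive1_comp d2 fd)).
by case: (D i j) => ? ? /=; ring.
Qed.

End MatrixDerivative.

(** * Real power series with infinite radius of convergence *)

Section RealPowerSeries.
Variable R : realType.
Implicit Types (a : nat -> R) (x : R).

(** By the Cauchy-Hadamard formula, the power series with coefficients a has
    infinite radius of convergence. *)
Definition rapid a := forall rho : R, 0 < rho ->
  exists C : R, forall k, `|a k| * rho ^+ k <= C.

Lemma rapid_cvg a x : rapid a -> cvgn (pseries a x).
Proof.
move=> ha; have rho0 : 0 < 2 * `|x| + 1 :> R by have := normr_ge0 x; lra.
have [C hC] := ha _ rho0; apply: normed_cvg.
have C0 : 0 <= C by rewrite (le_trans _ (hC 0)) ?mulr_ge0.
apply: (@series_le_cvg _ _ (geometric C (1/2))).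
- by move=> n /=; exact: normr_ge0.
- by move=> n /=; rewrite mulr_ge0// exprn_ge0.
- move=> n /=; rewrite normrM normrX.
  apply: (@le_trans _ _ (`|a n| * (2 * `|x| + 1) ^+ n * (1/2) ^+ n)).
    rewrite -mulrA -exprMn ler_wpM2l// lerXn2r ?nnegrE//; have := normr_ge0 x; lra.
  by rewrite ler_wpM2r// exprn_ge0.
- by apply: is_cvg_geometric_series; rewrite ger0_norm//; lra.
Qed.

(** The factor k + 1 is at most 2^(k+1), which is absorbed by doubling rho. *)
Lemma rapid_diffs a : rapid a -> rapid (pseries_diffs a).
Proof.
move=> ha rho rho0; have rho2 : 0 < 2 * rho by rewrite mulr_gt0.
have [C hC] := ha _ rho2; exists (C / rho) => k.
rewrite /pseries_diffs ler_pdivlMr// normrM normr_nat.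
have -> : k.+1%:R * `|a k.+1| * rho ^+ k * rho = `|a k.+1| * (k.+1%:R * rho ^+ k.+1).
  by rewrite exprSr; ring.
apply: le_trans (hC k.+1); rewrite exprMn ler_wpM2l//.
rewrite ler_wpM2r ?exprn_ge0 ?(ltW rho0)// -natrX ler_nat.
exact: ltnW (ltn_expl _ _).
Qed.

Lemma is_derive_pseries a x : rapid a ->
  is_derive x 1 (fun x => limn (pseries a x)) (limn (pseries (pseries_diffs a) x)).
Proof.
move=> ha; have hd := rapid_diffs ha; have hdd := rapid_diffs hd.
apply: (@pseries_snd_diffs _ a (`|x| + 1)); try exact: rapid_cvg.
by rewrite [ltRHS]ger0_norm ?addr_ge0// ltrDl.
Qed.

End RealPowerSeries.

(** * Matrix power series *)

Section MatrixPowerSeries.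
Variables (R : realType) (N : nat).
Implicit Types (c d : nat -> 'M[R[i]]_N) (x : R) (A : 'M[R[i]]_N).

Definition mxpartial c x := series (fun k : nat => (x ^+ k)%:C *: c k).
Definition mxseries c x : 'M[R[i]]_N := limn (mxpartial c x).

Definition mxrapid c := forall rho : R, 0 < rho ->
  exists C : R, forall k, mnorm (c k) * rho ^+ k <= C.

Lemma rapid_Re c i j : mxrapid c -> rapid (fun k => complex.Re (c k i j)).
Proof.
move=> hc rho r0; have [C hC] := hc _ r0; exists C => k.
apply: le_trans (hC k); rewrite ler_wpM2r ?exprn_ge0 ?(ltW r0)//.
by rewrite (le_trans (cabs_Re _))// cabs_le_mnorm.
Qed.

Lemma rapid_Im c i j : mxrapid c -> rapid (fun k => complex.Im (c k i j)).
Proof.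
move=> hc rho r0; have [C hC] := hc _ r0; exists C => k.
apply: le_trans (hC k); rewrite ler_wpM2r ?exprn_ge0 ?(ltW r0)//.
by rewrite (le_trans (cabs_Im _))// cabs_le_mnorm.
Qed.

(** The sum of a matrix series, as a matrix of real power series: limits and
    derivatives of matrix series are read on this form. *)
Definition mxseries_entries c x : 'M[R[i]]_N := \matrix_(i, j)
  (limn (pseries (fun k => complex.Re (c k i j)) x)
   +i* limn (pseries (fun k => complex.Im (c k i j)) x)).

Lemma Re_sum (I : Type) (s : seq I) (F : I -> R[i]) :
  complex.Re (\sum_(i <- s) F i) = \sum_(i <- s) complex.Re (F i).
Proof. by elim/big_ind2: _ => // z a w b <- <-; rewrite Re_add. Qed.

Lemma Im_sum (I : Type) (s : seq I) (F : I -> R[i]) :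
  complex.Im (\sum_(i <- s) F i) = \sum_(i <- s) complex.Im (F i).
Proof. by elim/big_ind2: _ => // z a w b <- <-; rewrite Im_add. Qed.

Lemma mxpartial_entries_cvg c x : mxrapid c ->
  mxpartial c x n @[n --> \oo] --> mxseries_entries c x.
Proof.
move=> hc; apply/cvg_mxP => i j; apply: cvg_ReIm; rewrite mxE /=.
  rewrite (_ : (fun n => _) = pseries (fun k => complex.Re (c k i j)) x).
    exact: rapid_cvg (rapid_Re i j hc).
  apply/funext => n; rewrite /mxpartial /pseries /series /= summxE Re_sum.
  by apply: eq_bigr => k _; rewrite mxE Re_mul /= mul0r subr0 mulrC.
rewrite (_ : (fun n => _) = pseries (fun k => complex.Im (c k i j)) x).
  exact: rapid_cvg (rapid_Im i j hc).
apply/funext => n; rewrite /mxpartial /pseries /series /= summxE Im_sum.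
by apply: eq_bigr => k _; rewrite mxE Im_mul /= mul0r addr0 mulrC.
Qed.

Lemma mxseriesE c x : mxrapid c -> mxseries c x = mxseries_entries c x.
Proof.
by move=> hc; apply: cvg_lim (mxpartial_entries_cvg hc); exact: mx_hausdorff.
Qed.

Lemma mxseries_cvg c x : mxrapid c ->
  mxpartial c x n @[n --> \oo] --> mxseries c x.
Proof. by move=> hc; rewrite mxseriesE//; exact: mxpartial_entries_cvg. Qed.

Lemma mxseries_unique c x L : mxpartial c x n @[n --> \oo] --> L ->
  mxseries c x = L.
Proof. by move=> h; apply: cvg_lim h; exact: mx_hausdorff. Qed.

Definition mxdiffs c : nat -> 'M[R[i]]_N := fun k => k.+1%:R *: c k.+1.

Lemma mxrapid_diffs c : mxrapid c -> mxrapid (mxdiffs c).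
Proof.
move=> hc rho rho0.
have hn : rapid (fun k => mnorm (c k)).
  by move=> r r0; have [C hC] := hc r r0; exists C => k; rewrite ger0_norm ?mnorm_ge0.
have [C hC] := rapid_diffs hn rho0; exists C => k; apply: le_trans (hC k).
rewrite /pseries_diffs /mxdiffs mnormZ cabs_nat normrM normr_nat.
by rewrite (ger0_norm (mnorm_ge0 _)).
Qed.

Lemma is_mxderive_mxseries c x : mxrapid c ->
  is_mxderive x (mxseries c) (mxseries (mxdiffs c) x).
Proof.
move=> hc i j; have hd := mxrapid_diffs hc.
have -> : (fun y => mxseries c y i j) = fun y => mxseries_entries c y i j.
  by apply/funext => y; rewrite mxseriesE.
rewrite mxseriesE//.
split.
  under eq_fun do rewrite mxE /=.
  rewrite mxE /=.
  have -> : (fun k => complex.Re (mxdiffs c k i j)) =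
     pseries_diffs (fun k => complex.Re (c k i j)).
    apply/funext => k; rewrite /mxdiffs /pseries_diffs mxE.
    by rewrite -(rmorph_nat (real_complex R)) Re_mul /= mul0r subr0.
  exact: is_derive_pseries (rapid_Re i j hc).
under eq_fun do rewrite mxE /=.
rewrite mxE /=.
have -> : (fun k => complex.Im (mxdiffs c k i j)) =
   pseries_diffs (fun k => complex.Im (c k i j)).
  apply/funext => k; rewrite /mxdiffs /pseries_diffs mxE.
  by rewrite -(rmorph_nat (real_complex R)) Im_mul /= mul0r addr0.
exact: is_derive_pseries (rapid_Im i j hc).
Qed.

Lemma mxseriesMl A c x : mxrapid c ->
  A *m mxseries c x = mxseries (fun k => A *m c k) x.
Proof.
move=> hc; symmetry; apply: mxseries_unique.
have -> : mxpartial (fun k => A *m c k) x = fun n => A *m mxpartial c x n.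
  apply/funext => n; rewrite /mxpartial /series /= mulmx_sumr.
  by apply: eq_bigr => k _; rewrite scalemxAr.
exact: cvg_mulmx (cvg_cst _) (mxseries_cvg hc).
Qed.

Lemma mxseriesMr A c x : mxrapid c ->
  mxseries c x *m A = mxseries (fun k => c k *m A) x.
Proof.
move=> hc; symmetry; apply: mxseries_unique.
have -> : mxpartial (fun k => c k *m A) x = fun n => mxpartial c x n *m A.
  apply/funext => n; rewrite /mxpartial /series /= mulmx_suml.
  by apply: eq_bigr => k _; rewrite scalemxAl.
exact: cvg_mulmx (mxseries_cvg hc) (cvg_cst _).
Qed.

Lemma mxseriesD c d x : mxrapid c -> mxrapid d ->
  mxseries c x + mxseries d x = mxseries (fun k => c k + d k) x.
Proof.
move=> hc hd; symmetry; apply: mxseries_unique.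
have -> : mxpartial (fun k => c k + d k) x
        = fun n => mxpartial c x n + mxpartial d x n.
  apply/funext => n; rewrite /mxpartial /series /= -big_split.
  by apply: eq_bigr => k _ /=; rewrite scalerDr.
exact: cvg_addmx (mxseries_cvg hc) (mxseries_cvg hd).
Qed.

Lemma mxseries_shift c x : mxrapid (fun k => c k.+1) ->
  mxseries c x = c 0%N + x%:C *: mxseries (fun k => c k.+1) x.
Proof.
move=> hc; apply: mxseries_unique; rewrite -cvg_shiftS.
have -> : (fun n => mxpartial c x n.+1)
        = fun n => c 0%N + x%:C%:M *m mxpartial (fun k => c k.+1) x n.
  apply/funext => n; rewrite /mxpartial /series /= big_nat_recl//.
  rewrite expr0 scale1r mul_scalar_mx scaler_sumr; congr (_ + _).
  by apply: eq_bigr => k _; rewrite scalerA -rmorphM -exprS.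
rewrite -mul_scalar_mx.
exact: cvg_addmx (cvg_cst _) (cvg_mulmx (cvg_cst _) (mxseries_cvg hc)).
Qed.

End MatrixPowerSeries.

(** * Powers of a positive real with matrix exponent *)

Section MatrixExponential.
Variables (R : realType) (N : nat).
Implicit Types (A : 'M[R[i]]_N) (x : R).

Definition expc A (k : nat) : 'M[R[i]]_N := (k`!%:R)^-1 *: A ^+ k.

Lemma exprn_fact_le (t : R) k : 0 <= t -> t ^+ k / k`!%:R <= expR t.
Proof.
move=> t0; case: k => [|k].
  by rewrite expr0 fact0 invr1 mulr1 -expR0 ler_expR.
by apply: le_trans (expR_ge1Dxn k t0); rewrite lerDr.
Qed.

Lemma mxrapid_expc A : mxrapid (expc A).
Proof.
move=> rho rho0; exists (N%:R * expR (mnorm A * rho)) => k.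
rewrite mnormZ cabsV cabs_nat.
apply: (@le_trans _ _ (k`!%:R^-1 * (N%:R * mnorm A ^+ k) * rho ^+ k)).
  rewrite ler_wpM2r ?exprn_ge0 ?(ltW rho0)// ler_wpM2l ?invr_ge0//.
  exact: mnormX_le.
have -> : k`!%:R^-1 * (N%:R * mnorm A ^+ k) * rho ^+ k
   = N%:R * ((mnorm A * rho) ^+ k / k`!%:R) by rewrite exprMn; ring.
by rewrite ler_wpM2l// exprn_fact_le// mulr_ge0 ?mnorm_ge0 ?ltW.
Qed.

Lemma rpow_mxE A x : rpow_mx x A = mxseries (expc A) (ln x).
Proof.
rewrite /rpow_mx /mxexp /mxseries; congr (limn _).
apply/funext => n; rewrite /mxpartial /series /=; apply: eq_bigr => k _.
rewrite /expc scalerA mulrC -scalerA; congr (_ *: _).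
elim: k => [|k ih]; first by rewrite !expr0 scale1r.
rewrite exprS ih -[LHS]/((_ *: A) *m (_ *: A ^+ k)) -scalemxAl -scalemxAr scalerA.
by rewrite -rmorphM -exprS [A ^+ k.+1]exprS.
Qed.

Lemma mxdiffs_expc A k : mxdiffs (expc A) k = A *m expc A k.
Proof.
rewrite /mxdiffs /expc scalerA factS natrM invfM mulrA mulfV ?mul1r; last first.
  exact: natc_neq0.
by rewrite -scalemxAr exprS.
Qed.

Lemma rpow_mx_comm A x : A *m rpow_mx x A = rpow_mx x A *m A.
Proof.
rewrite rpow_mxE mxseriesMl ?mxseriesMr; try exact: mxrapid_expc.
congr (mxseries _ _); apply/funext => k.
by rewrite /expc -scalemxAl -scalemxAr -[A *m _]exprS -[_ *m A]exprSr.
Qed.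

(** x^A is the series exp(sA) in s = ln x, whose derivative is A exp(sA). *)
Lemma is_mxderive_rpow_mx A x : 0 < x ->
  is_mxderive x (fun y => rpow_mx y A) ((x^-1)%:C *: (A *m rpow_mx x A)).
Proof.
move=> x0.
have -> : (fun y => rpow_mx y A) = mxseries (expc A) \o (@ln R).
  by apply/funext => y; rewrite rpow_mxE.
have -> : A *m rpow_mx x A = mxseries (mxdiffs (expc A)) (ln x).
  rewrite rpow_mxE mxseriesMl; last exact: mxrapid_expc.
  by congr (mxseries _ _); apply/funext => k; rewrite mxdiffs_expc.
apply: is_mxderive_comp; first exact: is_derive1_ln.
exact: is_mxderive_mxseries (mxrapid_expc A).
Qed.

End MatrixExponential.

(** * Young's function and its derivatives *)

Section YoungFunction.
Variables (R : realType) (N : nat).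
Implicit Types (A B M : 'M[R[i]]_N) (x u : R).

(** The recurrence Γ^-1(M) = M Γ^-1(M + I), the source of everything below. *)
Lemma rgamma_mx_shift M : rgamma_mx M = M *m rgamma_mx (M + 1%:M).
Proof.
by apply: mxholo_shift; [exact: poly_approx_rgamma..|exact: rgamma_shift].
Qed.

(** Ratio test: from the rank n on, the sequence |D k| rho^k decreases. *)
Lemma mxrapid_ratio (D : nat -> 'M[R[i]]_N) :
  (forall rho : R, 0 < rho -> exists n, forall k, (n <= k)%N ->
     mnorm (D k.+1) * rho <= mnorm (D k)) -> mxrapid D.
Proof.
move=> h rho rho0; have [n hn] := h rho rho0.
pose a k := mnorm (D k) * rho ^+ k.
have a0 k : 0 <= a k by rewrite mulr_ge0 ?mnorm_ge0 ?exprn_ge0 ?ltW.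
exists (\sum_(l < n.+1) a l) => k; rewrite -/(a k).
have small l : (l <= n)%N -> a l <= \sum_(l < n.+1) a l.
  move=> ln; rewrite (bigD1 (Ordinal (ln : (l < n.+1)%N)))//= lerDl.
  by apply: sumr_ge0.
have [/small//|nk] := leqP k n.
rewrite -(subnKC (ltnW nk)); elim: (k - n)%N => [|j ih].
  by rewrite addn0 small.
apply: le_trans ih; rewrite addnS /a exprS mulrA ler_wpM2r ?exprn_ge0 ?(ltW rho0)//.
by rewrite hn// leq_addr.
Qed.

(** With D_k = Γ^-1(B + (k+1)I), the recurrence reads
    D_k = B D_(k+1) + (k+1) D_(k+1), whence (k + 1 - |B|) |D_(k+1)| <= |D_k|. *)
Lemma mxrapid_rgamma B : mxrapid (fun k => rgamma_mx (B + k.+1%:R%:M)).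
Proof.
have aux (d b m K r : R) : K * d <= m + b * d -> b + r <= K -> 0 <= d -> d * r <= m.
  by nra.
apply: mxrapid_ratio => rho rho0.
exists (Num.truncn (mnorm B + rho)).+1 => k nk.
have kB : mnorm B + rho <= k.+1%:R.
  by rewrite (le_trans (ltW (truncnS_gt _)))// ler_nat ltnW// ltnS.
set D := rgamma_mx (B + k.+2%:R%:M).
have E : rgamma_mx (B + k.+1%:R%:M) = B *m D + k.+1%:R *: D.
  rewrite rgamma_mx_shift -addrA -raddfD natr1 mulmxDl mul_scalar_mx.
  by rewrite -[in X in _ + X]natr1.
have kD : k.+1%:R * mnorm D <= mnorm (rgamma_mx (B + k.+1%:R%:M)) + mnorm B * mnorm D.
  have -> : k.+1%:R * mnorm D = mnorm (k.+1%:R *: D) by rewrite mnormZ cabs_nat.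
  have -> : k.+1%:R *: D = rgamma_mx (B + k.+1%:R%:M) - B *m D.
    by rewrite E addrC addKr.
  by rewrite (le_trans (mnormD _ _))// mnormN lerD2l mnormM.
exact: aux kD kB (mnorm_ge0 D).
Qed.

Definition young_coef B (k : nat) : 'M[R[i]]_N :=
  ((-1) ^+ k)%:C *: rgamma_mx (B + (2 * k + 1)%:R%:M).

Lemma mxrapid_young_coef B : mxrapid (young_coef B).
Proof.
move=> rho rho0; pose s := Num.max 1 rho.
have s1 : 1 <= s by rewrite le_max lexx.
have s0 : 0 < s by rewrite (lt_le_trans _ s1).
have [C hC] := mxrapid_rgamma B s0; exists C => k.
apply: le_trans (hC (2 * k)%N).
rewrite mnormZ cabsR normrX normrN normr1 expr1n mul1r addn1.
rewrite ler_wpM2l ?mnorm_ge0//.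
apply: (@le_trans _ _ (s ^+ k)).
  by rewrite lerXn2r ?nnegrE ?(ltW rho0) ?(ltW s0)// le_max lexx orbT.
by rewrite ler_weXn2l// mul2n -addnn leq_addr.
Qed.

Lemma mxrapid_mull A (c : nat -> 'M[R[i]]_N) : mxrapid c -> mxrapid (fun k => A *m c k).
Proof.
move=> hc rho rho0; have [C hC] := hc rho rho0; exists (mnorm A * C) => k.
apply: (@le_trans _ _ (mnorm A * mnorm (c k) * rho ^+ k)).
  by rewrite ler_wpM2r ?exprn_ge0 ?(ltW rho0)// mnormM.
by rewrite -mulrA ler_wpM2l ?mnorm_ge0.
Qed.

(** Expanding in u = x^2 turns the even series of Young's function into an
    ordinary power series. *)
Definition young_series B u := mxseries (young_coef B) u.

Lemma young_mxE A x : young_mx A x = rpow_mx x A *m young_series A (x ^+ 2).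
Proof.
apply: (congr1 (fun s : nat -> 'M[R[i]]_N => rpow_mx x A *m limn s)).
apply/funext => n; rewrite /mxpartial /series /=; apply: eq_bigr => k _.
by rewrite /young_coef scalerA -rmorphM -exprM mulrC.
Qed.

(** The recurrence at B + 2kI: Γ^-1(B + 2kI) = (B + 2kI) Γ^-1(B + (2k+1)I). *)
Lemma young_coef_pred B k :
  young_coef (B - 1%:M) k + (- B) *m young_coef B k
  = (2 * k)%:R *: young_coef B k.
Proof.
rewrite /young_coef -scalemxAr scalerA mulrC -scalerA -scalerDr; congr (_ *: _).
have -> : B - 1%:M + (2 * k + 1)%:R%:M = B + (2 * k)%:R%:M.
  by rewrite natrD raddfD /= addrA addrAC addrNK.
have -> : rgamma_mx (B + (2 * k)%:R%:M)
    = (B + (2 * k)%:R%:M) *m rgamma_mx (B + (2 * k + 1)%:R%:M).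
  by rewrite rgamma_mx_shift -addrA -raddfD natr1 addn1.
by rewrite mulmxDl mulNmx addrC addKr mul_scalar_mx.
Qed.

(** The operator B + 2u d/du multiplies the k-th coefficient by B + 2k, that is,
    it replaces B by B - I. *)
Lemma young_series_pred B u : young_series (B - 1%:M) u =
  B *m young_series B u + (2 * u)%:C *: mxseries (mxdiffs (young_coef B)) u.
Proof.
have hB := mxrapid_young_coef B.
rewrite [RHS]addrC; apply/eqP; rewrite -subr_eq -mulNmx; apply/eqP.
have key (d : nat -> 'M[R[i]]_N) : (forall k, d k = (2 * k)%:R *: young_coef B k) ->
    mxseries d u = (2 * u)%:C *: mxseries (mxdiffs (young_coef B)) u.
  move=> dE.
  have E : (fun k => d k.+1) = fun k => (2 : R[i])%:M *m mxdiffs (young_coef B) k.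
    by apply/funext => k; rewrite dE mul_scalar_mx /mxdiffs scalerA natrM.
  have h2 := mxrapid_mull (2 : R[i])%:M (mxrapid_diffs hB).
  have h3 : mxrapid (fun k => d k.+1) by rewrite E.
  rewrite (@mxseries_shift R N d u h3) E dE muln0 scale0r add0r.
  rewrite -(mxseriesMl _ _ (mxrapid_diffs hB)) mul_scalar_mx scalerA.
  by rewrite mulrC rmorphM rmorph_nat.
rewrite -(key _ (fun k => young_coef_pred B k)).
rewrite /young_series (mxseriesMl _ _ hB).
exact: mxseriesD (mxrapid_young_coef _) (mxrapid_mull _ hB).
Qed.

(** Moving the index by one adds 2I to the argument of Γ^-1 and changes the
    sign, so that all terms cancel except the constant one. *)
Lemma young_series_add2 B u :
  young_series B u + u%:C *: young_series (B + 2%:R%:M) u = rgamma_mx (B + 1%:M).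
Proof.
have h2 := mxrapid_young_coef (B + 2%:R%:M).
have E : (fun k => young_coef B k.+1) = fun k => (- 1%:M) *m young_coef (B + 2%:R%:M) k.
  apply/funext => k; rewrite mulNmx mul1mx /young_coef exprS mulN1r rmorphN scaleNr.
  congr (- (_ *: rgamma_mx _)); rewrite -addrA -raddfD -natrD.
  by congr (_ + _%:R%:M); rewrite mulnS addnA.
rewrite /young_series [X in X + _]mxseries_shift E; last exact: mxrapid_mull.
rewrite -mxseriesMl// mulNmx mul1mx scalerN addrNK.
by rewrite /young_coef expr0 scale1r muln0 add0n.
Qed.

(** The closed form x^(A - jI) C_(A-jI)(x^2) of the j-th derivative of Y_A. *)
Definition young_deriv A j x : 'M[R[i]]_N :=
  (x^-1 ^+ j)%:C *: (rpow_mx x A *m young_series (A - j%:R%:M) (x ^+ 2)).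

Lemma is_derive_invX x j : x != 0 ->
  is_derive x 1 (fun y : R => y^-1 ^+ j) (- j%:R * x^-1 ^+ j.+1).
Proof.
move=> x0.
have -> : (fun y : R => y^-1 ^+ j) = (fun y : R => y^-1) ^+ j.
  by apply/funext => y; rewrite exprfctE.
apply: (is_derive_eq (is_deriveX _ (is_deriveV (f := id) x0 (is_derive_id _ _)))).
rewrite /GRing.scale /= mulr1; case: j => [|j]; first by rewrite !mul0r oppr0 mul0r.
by rewrite /= -exprVn mulrN mulNr -mulrA -exprD addn2.
Qed.

(** The noncommutative bookkeeping of is_mxderive_young_deriv, for arbitrary
    matrices: p and q stand for x^-j and x^-(j+1), n for j, r for x^-1, s for
    2x and s' for 2x^2. *)
Lemma young_deriv_algebra (E B G G' : 'M[R[i]]_N) (p q n r s s' : R[i]) :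
  p * r = q -> p * s = q * s' ->
  (- (n * q)) *: (E *m G)
    + p *: ((r *: (E *m B + n *: E)) *m G + E *m (s *: G'))
  = q *: (E *m (B *m G + s' *: G')).
Proof.
move=> hp hs; rewrite mulmxDr mulmxA -scalemxAl -!scalemxAr mulmxDl -scalemxAl.
rewrite !scalerDr !scalerA hp hs (mulrC q n) scaleNr -!addrA.
by rewrite addrCA (addrA (- _)) addNr add0r.
Qed.

(** Differentiating x^-j, x^A and C_(A-jI)(x^2) in turn gives x^(A-(j+1)I) times
    (A - jI) C + 2 x^2 C', which is C_(A-(j+1)I)(x^2). *)
Lemma is_mxderive_young_deriv A j x : 0 < x ->
  is_mxderive x (young_deriv A j) (young_deriv A j.+1 x).
Proof.
move=> x0; set B := A - j%:R%:M.
have dE := is_mxderive_rpow_mx A x0.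
have dsq : is_derive x 1 (fun y : R => y ^+ 2) (2 * x).
  have -> : (fun y : R => y ^+ 2) = id ^+ 2 by apply/funext => y; rewrite exprfctE.
  apply: (is_derive_eq (is_deriveX _ (is_derive_id _ _))).
  by rewrite /GRing.scale /= mulr1 expr1.
have dG : is_mxderive x (young_series B \o (fun y => y ^+ 2))
    ((2 * x)%:C *: mxseries (mxdiffs (young_coef B)) (x ^+ 2)).
  apply: (@is_mxderive_comp R N N x (fun y => y ^+ 2) _ _ _ dsq).
  exact: is_mxderive_mxseries (mxrapid_young_coef B).
have := is_mxderiveZ (is_derive_invX j (lt0r_neq0 x0)) (is_mxderiveM dE dG).
rewrite /=; set D := (X in is_mxderive _ _ X); suff -> : D = young_deriv A j.+1 x by [].
have Bpred : A - j.+1%:R%:M = B - 1%:M.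
  by rewrite -natr1 raddfD /= opprD addrA.
rewrite /young_deriv Bpred young_series_pred /D.
set E := rpow_mx x A; set G := young_series B (x ^+ 2).
set G' := mxseries _ _.
have AE : A *m E = E *m B + j%:R *: E.
  by rewrite /E rpow_mx_comm -{2}(subrK j%:R%:M A) mulmxDr mul_mx_scalar.
have xj : x^-1 ^+ j * (2 * x) = x^-1 ^+ j.+1 * (2 * x ^+ 2).
  by rewrite exprSr; field; rewrite gt_eqF.
have := @young_deriv_algebra E B G G' (x^-1 ^+ j)%:C (x^-1 ^+ j.+1)%:C j%:R
  (x^-1)%:C (2 * x)%:C (2 * x ^+ 2)%:C.
rewrite -!rmorphM /= -exprSr xj => /(_ erefl erefl) <-.
by rewrite -AE mulNr rmorphN rmorphM rmorph_nat.
Qed.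

Lemma young_mx_deriv0 A x : young_mx A x = young_deriv A 0 x.
Proof. by rewrite /young_deriv expr0 scale1r raddf0 subr0 -young_mxE. Qed.

Lemma mxderiven_young A k x : 0 < x -> mxderiven k (young_mx A) x = young_deriv A k x.
Proof.
elim: k x => [|k ih] x x0; first exact: young_mx_deriv0.
rewrite /mxderiven iterS -/(mxderiven k _); apply: mxderive_is.
apply: is_mxderive_near (is_mxderive_young_deriv A k x0).
near=> y; rewrite ih//; near: y; exact: lt_nbhsr.
Unshelve. all: by end_near. Qed.

Lemma mxderivable_young A k x : 0 < x -> mxderivable (mxderiven k (young_mx A)) x.
Proof.
move=> x0; apply: (@mxderivable_is _ _ _ _ (young_deriv A k.+1 x)).
apply: is_mxderive_near (is_mxderive_young_deriv A k x0).
near=> y; rewrite mxderiven_young//; near: y; exact: lt_nbhsr.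
Unshelve. all: by end_near. Qed.

End YoungFunction.

(** * The differential equation *)

Section YoungEquation.
Variables (R : realType) (N : nat).
Implicit Types (A : 'M[R[i]]_N) (x : R).

Lemma young_series_gap A j u :
  young_series (A - j.+2%:R%:M) u + u%:C *: young_series (A - j%:R%:M) u
  = rgamma_mx (A - j.+1%:R%:M).
Proof.
have -> : A - j%:R%:M = (A - j.+2%:R%:M) + 2%:R%:M.
  by rewrite -addrA; congr (_ + _); rewrite -addn2 natrD raddfD opprD addrNK.
rewrite young_series_add2; congr rgamma_mx.
by rewrite -addrA; congr (_ + _); rewrite -(addn1 j.+1) natrD raddfD opprD addrNK.
Qed.

(** Here x^2 x^-(j+2) = x^-j matches the factor u of young_series_gap. *)
Lemma young_deriv_gap A j x : x != 0 ->
  young_deriv A j.+2 x + young_deriv A j x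
  = (x^-1 ^+ j.+2)%:C *: (rpow_mx x A *m rgamma_mx (A - j.+1%:R%:M)).
Proof.
move=> x0; rewrite -(young_series_gap A j (x ^+ 2)) mulmxDr -scalemxAr scalerDr.
rewrite scalerA -rmorphM /=; congr (_ + _%:C *: _).
by rewrite -[j.+2]addn2 exprD -mulrA -exprMn mulVf// expr1n mulr1.
Qed.

(** Grouping Y''' with Y' and Y'' with Y leaves Γ^-1(A - 2I) and
    (2I - A) Γ^-1(A - I), which are opposite by the recurrence. *)
Lemma young_ode A x : 0 < x ->
  x%:C *: young_deriv A 3 x + (2 *: 1%:M - A) *m young_deriv A 2 x
  + x%:C *: young_deriv A 1 x + (2 *: 1%:M - A) *m young_deriv A 0 x = 0.
Proof.
move=> x0; have xn0 := lt0r_neq0 x0.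
have := young_deriv_gap A 1 xn0; have := young_deriv_gap A 0 xn0.
move: (young_deriv A 0 x) (young_deriv A 1 x) (young_deriv A 2 x)
  (young_deriv A 3 x) => Y0 Y1 Y2 Y3 h2 h3.
have -> : x%:C *: Y3 + (2 *: 1%:M - A) *m Y2 + x%:C *: Y1 + (2 *: 1%:M - A) *m Y0
    = x%:C *: (Y3 + Y1) + (2 *: 1%:M - A) *m (Y2 + Y0).
  by rewrite scalerDr mulmxDr -addrA addrACA.
rewrite h2 h3 scalerA.
have -> : x%:C * (x^-1 ^+ 3)%:C = (x^-1 ^+ 2)%:C.
  by rewrite -rmorphM exprS mulrA mulfV// mul1r.
have -> : rgamma_mx (A - 2%:R%:M) = (A - 2%:R%:M) *m rgamma_mx (A - 1%:R%:M).
  rewrite rgamma_mx_shift; congr (_ *m rgamma_mx _).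
  by rewrite -addrA -[in 2%:R%:M](addn1 1) natrD raddfD opprD addrNK.
have EA : rpow_mx x A *m (A - 2%:R%:M) = (A - 2%:R%:M) *m rpow_mx x A.
  by rewrite mulmxBr mulmxBl rpow_mx_comm scalar_mxC.
move: (rgamma_mx (A - 1%:R%:M)) => T.
rewrite mulmxA EA -scalemxAr -scalerDr mulmxA -mulmxDl -mulmxDl.
by rewrite scalemx1 addrC subrKA subrr !mul0mx scaler0.
Qed.

End YoungEquation.

Theorem theorem4p13 (R : realType) (N : nat) (A : 'M[R[i]]_N)
  (hA1 : forall s : nat, 2^-1 *: (A + 1%:M) + s%:R *: 1%:M \in unitmx)
  (hA2 : forall s : nat,
     2^-1 *: (A + 2 *: 1%:M) + s%:R *: 1%:M \in unitmx)
  (x : R) (hx : 0 < x) :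
  (forall k : nat, (k < 3)%N -> mxderivable (mxderiven k (young_mx A)) x) /\
  x%:C *: mxderiven 3 (young_mx A) x
  + (2 *: 1%:M - A) *m mxderiven 2 (young_mx A) x
  + x%:C *: mxderiven 1 (young_mx A) x
  + (2 *: 1%:M - A) *m young_mx A x = 0.
Proof.
split=> [k _|]; first exact: mxderivable_young.
by rewrite !mxderiven_young// young_mx_deriv0 young_ode.
Qed.
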